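(* Let $A$ be a group, let $C,D$ be infinite cyclic subgroups of $A$ with an isomorphism between them, and let $G=A\ast_C=\langle A,t\mid t^{-1}Ct=D\rangle$ be the corresponding HNN extension (with stable letter $t$ conjugating $C$ onto $D$). If $G$ has the unique root property, then the abstract commensurator $\mathrm{Comm}(G)$ is not finitely generated.
   Context: A group has the unique root property if for all $x,y$ in it and every positive integer $n$, $x^n=y^n$ implies $x=y$. The abstract commensurator $\mathrm{Comm}(G)$ of a group $G$ is the group of equivalence classes of isomorphisms between finite-index subgroups of $G$, two such isomorphisms being equivalent if they agree on some finite-index subgroup of $G$ on which both are defined; the product of $\alpha:G_1\to G_1'$ and $\beta:G_2\to G_2'$ is $\alpha\beta:\alpha^{-1}(G_1'\cap G_2)\to\beta(G_1'\cap G_2)$. *)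

(* Defs.v *)
From Stdlib Require Import ZArith List.
Set Implicit Arguments.

Record Group := {
  gcar :> Type;
  gmul : gcar -> gcar -> gcar;
  ginv : gcar -> gcar;
  gone : gcar;
  gassoc : forall x y z, gmul x (gmul y z) = gmul (gmul x y) z;
  gone_l : forall x, gmul gone x = x;
  ginv_l : forall x, gmul (ginv x) x = gone }.

Arguments gmul {g}. Arguments ginv {g}. Arguments gone {g}.

Fixpoint npow {G : Group} (x : G) (n : nat) : G :=
  match n with O => gone | S m => gmul x (npow x m) end.

Definition zpow {G : Group} (x : G) (z : Z) : G :=
  match z with
  | Z0 => gone
  | Zpos p => npow x (Pos.to_nat p)
  | Zneg p => ginv (npow x (Pos.to_nat p))
  end.

Definition is_hom {G H : Group} (f : G -> H) : Prop :=
  forall x y, f (gmul x y) = gmul (f x) (f y).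

Definition subgroup {G : Group} (K : G -> Prop) : Prop :=
  K gone /\ (forall x y, K x -> K y -> K (gmul x y)) /\ (forall x, K x -> K (ginv x)).

Definition finite_index {G : Group} (K : G -> Prop) : Prop :=
  subgroup K /\
  exists reps : list G, forall g, exists r, In r reps /\ K (gmul (ginv r) g).

Definition infinite_cyclic {G : Group} (K : G -> Prop) : Prop :=
  exists c : G, (forall h, K h <-> exists n : Z, h = zpow c n) /\
                (forall n : Z, zpow c n = gone -> n = 0%Z).

Definition iso_on {G : Group} (K L : G -> Prop) (f : G -> G) : Prop :=
  (forall x y, K x -> K y -> f (gmul x y) = gmul (f x) (f y)) /\
  (forall x, K x -> L (f x)) /\
  (forall x y, K x -> K y -> f x = f y -> x = y) /\
  (forall y, L y -> exists x, K x /\ f x = y).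

Definition unique_root (G : Group) : Prop :=
  forall (x y : G) (n : nat), (0 < n)%nat -> npow x n = npow y n -> x = y.

(** * HNN extension  G = < A, t | t^-1 c t = phi c  (c in C) >,
    characterised by its universal property: i : A -> G, t : G. *)
Definition is_HNN {A G : Group} (C : A -> Prop) (phi : A -> A)
    (i : A -> G) (t : G) : Prop :=
  is_hom i /\
  (forall c, C c -> gmul (ginv t) (gmul (i c) t) = i (phi c)) /\
  (forall (H : Group) (j : A -> H) (s : H),
     is_hom j ->
     (forall c, C c -> gmul (ginv s) (gmul (j c) s) = j (phi c)) ->
     exists f : G -> H,
       is_hom f /\ (forall a, f (i a) = j a) /\ f t = s /\
       (forall f' : G -> H, is_hom f' -> (forall a, f' (i a) = j a) -> f' t = s ->
          forall g, f' g = f g)).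

Record PIso (G : Group) := { pdom : G -> Prop; pcod : G -> Prop; pmap : G -> G }.

Definition is_comm {G : Group} (a : PIso G) : Prop :=
  finite_index (pdom a) /\ finite_index (pcod a) /\ iso_on (pdom a) (pcod a) (pmap a).

Definition comm_equiv {G : Group} (a b : PIso G) : Prop :=
  exists K : G -> Prop, finite_index K /\
    forall x, K x -> pdom a x /\ pdom b x /\ pmap a x = pmap b x.

Definition pid (G : Group) : PIso G :=
  {| pdom := fun _ => True; pcod := fun _ => True; pmap := fun x => x |}.

Definition pcomp {G : Group} (a b : PIso G) : PIso G :=
  {| pdom := fun x => pdom a x /\ pcod a (pmap a x) /\ pdom b (pmap a x);
     pcod := fun y => exists x, pdom a x /\ pcod a (pmap a x) /\ pdom b (pmap a x)
                                /\ y = pmap b (pmap a x);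
     pmap := fun x => pmap b (pmap a x) |}.

(** Elements of Comm(G) (given by representatives) lying in the subgroup
    generated by the classes of the elements of S. *)
Inductive comm_gen {G : Group} (S : list (PIso G)) : PIso G -> Prop :=
  | cg_base : forall a, In a S -> comm_gen S a
  | cg_id : comm_gen S (pid G)
  | cg_comp : forall a b, comm_gen S a -> comm_gen S b -> comm_gen S (pcomp a b)
  | cg_inv : forall a b, comm_gen S a -> is_comm b ->
               comm_equiv (pcomp a b) (pid G) -> comm_gen S b
  | cg_equiv : forall a b, comm_gen S a -> is_comm b -> comm_equiv a b -> comm_gen S b.

Definition comm_fin_gen (G : Group) : Prop :=
  exists S : list (PIso G), (forall a, In a S -> is_comm a) /\
    forall b, is_comm b -> comm_gen S b.

(* Main.v *)
Require Import Defs.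
From Stdlib Require Import ZArith List Lia Bool Znumtheory Factorial FinFun.
From Stdlib Require Import Classical ClassicalEpsilon FunctionalExtensionality.
From Stdlib Require Import PropExtensionality ProofIrrelevance.

(** If Comm(G) were generated by finitely many commensurations, all of index at
    most N, choose p prime to 1, .., N. Every element of Comm(G) would then have a
    representative f on a subgroup K in which every element of G has a power of
    exponent prime to p: this property passes to preimages and images under partial
    isomorphisms, hence to products and inverses.

    Let G_p be the p-fold cyclic cover of G, the kernel of G -> Z/p, t |-> 1, A |-> 0,
    and T the Dehn twist of G_p along one of its p edges: T fixes t^k a t^-k for a in A
    and 0 <= k < p and maps t^p to t^(p-1) c t, where c generates C. If T were
    represented by such an f, then some t^m with m prime to p would lie in K, and unique
    roots would give z in G with z^p = t^(p-1) c t and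
    T (t h t^-1) = z (T h) z^-1 for h in G_p. Writing z = t w, the elements w,
    t^-1 w t and t^-2 w t^2 centralize A.

    By normal forms in the HNN extension, either w is a power of c, or A is C or D
    and w lies in a conjugate of A by a power of t. Either w = 1, which is absurd, or
    t^-1 c^x t = c^y with x, y coprime and w^b = c^a where b divides a power of x y.
    Expanding (t w)^p shows that x^(p-1) + x^(p-2) y + .. + y^(p-1) divides a power
    of x y, although it is prime to x y and, for p odd and x + y <> 0, at least 2;
    x + y = 0 would give (t c^x)^2 = t^2. *)

(** * Homogeneous geometric sums *)

Section GeometricSums.
Local Open Scope Z_scope.

(* [geom x y n] is the sum of [x^(n-1-k) y^k] for [k < n]. *)
Fixpoint geom (x y : Z) (n : nat) : Z :=
  match n with O => 0 | S m => x * geom x y m + y ^ Z.of_nat m end.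

Lemma Zpow_S x n : x ^ Z.of_nat (S n) = x * x ^ Z.of_nat n.
Proof. rewrite Nat2Z.inj_succ; apply Z.pow_succ_r; lia. Qed.

(** The sum is symmetric in [x] and [y], so it can also be peeled from its other end. *)
Lemma geom_S' x y n : geom x y (S n) = y * geom x y n + x ^ Z.of_nat n.
Proof.
  induction n as [|n IH]; [simpl; lia|].
  change (geom x y (S (S n))) with (x * geom x y (S n) + y ^ Z.of_nat (S n)).
  rewrite IH at 1; change (geom x y (S n)) with (x * geom x y n + y ^ Z.of_nat n).
  rewrite !Zpow_S; ring.
Qed.

Lemma rel_prime_pow a b n : rel_prime a b -> rel_prime (a ^ Z.of_nat n) b.
Proof.
  intros H; induction n as [|n IH]; [apply rel_prime_1|].
  rewrite Zpow_S; apply rel_prime_sym, rel_prime_mult; now apply rel_prime_sym.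
Qed.

Lemma rel_prime_addmul a b k : rel_prime a b -> rel_prime (b * k + a) b.
Proof.
  intros H; apply rel_prime_bezout in H as [u v H]; apply bezout_rel_prime.
  apply (Bezout_intro _ _ _ u (v - u * k)); rewrite <- H; ring.
Qed.

(** Modulo [x] only the term [y^n] survives, and modulo [y] only [x^n]. *)
Lemma geom_rel_prime x y n : rel_prime x y -> rel_prime (geom x y (S n)) (x * y).
Proof.
  intros H; apply rel_prime_mult.
  - apply rel_prime_addmul, rel_prime_pow; now apply rel_prime_sym.
  - rewrite geom_S'; now apply rel_prime_addmul, rel_prime_pow.
Qed.

(** Two steps of the recursion multiply the sum by [x^2] and add [y^(2k) * y(x+y)], or by symmetry
    multiply it by [y^2] and add [x^(2k) * x(x+y)]. Since [y(x+y)] and [x(x+y)] add up to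
    [(x+y)^2 > 0], one of the two corrections is positive. *)
Lemma geom_odd_step x y k :
  x <> 0 -> y <> 0 -> x + y <> 0 -> 1 <= geom x y (2 * k + 1) ->
  2 <= geom x y (2 * k + 3).
Proof.
  intros Hx Hy Hxy H; set (n := (2 * k + 1)%nat) in *.
  replace (2 * k + 3)%nat with (S (S n)) by lia.
  assert (sq : forall z, z <> 0 -> 0 < z ^ Z.of_nat (2 * k)).
  { intros z Hz; rewrite Nat2Z.inj_mul, Z.pow_mul_r by lia.
    apply Z.pow_pos_nonneg; [|lia]; change (Z.of_nat 2) with 2.
    rewrite Z.pow_2_r; nia. }
  assert (E1 : geom x y (S (S n)) = x * x * geom x y n + y ^ Z.of_nat (2 * k) * (y * (x + y))).
  { change (geom x y (S (S n))) with (x * (x * geom x y n + y ^ Z.of_nat n) + y ^ Z.of_nat (S n)).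
    unfold n; rewrite Zpow_S; rewrite Nat.add_1_r, Zpow_S; ring. }
  assert (E2 : geom x y (S (S n)) = y * y * geom x y n + x ^ Z.of_nat (2 * k) * (x * (x + y))).
  { rewrite 2!geom_S'; rewrite Zpow_S; unfold n; rewrite Nat.add_1_r, Zpow_S; ring. }
  destruct (Z_lt_le_dec 0 (y * (x + y))) as [P|P].
  - rewrite E1; pose proof (sq y Hy); nia.
  - assert (0 < x * (x + y)) by nia.
    rewrite E2; pose proof (sq x Hx); nia.
Qed.

Lemma geom_odd_ge2 x y k :
  x <> 0 -> y <> 0 -> x + y <> 0 -> 2 <= geom x y (2 * k + 3).
Proof.
  intros Hx Hy Hxy; induction k as [|k IH]; apply geom_odd_step; trivial.
  - simpl; lia.
  - replace (2 * S k + 1)%nat with (2 * k + 3)%nat by lia; lia.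
Qed.

(** A divisor of a power of [x * y] that is prime to [x * y] is a unit, whereas this sum is at least
    2. *)
Lemma geom_not_dvd_pow x y k n :
  rel_prime x y -> x <> 0 -> y <> 0 -> x + y <> 0 ->
  ~ (geom x y (2 * k + 3) | (x * y) ^ Z.of_nat n).
Proof.
  intros Hp Hx Hy Hxy D; pose proof (geom_odd_ge2 x y k Hx Hy Hxy) as H.
  replace (2 * k + 3)%nat with (S (2 * k + 2)) in * by lia.
  pose proof (rel_prime_pow _ _ n (rel_prime_sym _ _ (geom_rel_prime x y (2 * k + 2) Hp))) as R.
  destruct R as [_ _ R]; pose proof (R _ D (Z.divide_refl _)) as D1.
  apply Z.divide_1_r_nonneg in D1; lia.
Qed.

End GeometricSums.

Declare Scope grp_scope.
Delimit Scope grp_scope with grp.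
Bind Scope grp_scope with gcar.
Local Open Scope grp_scope.
Local Notation "x * y" := (gmul x y) : grp_scope.
Local Notation "x ^-1" := (ginv x) (at level 9, format "x ^-1") : grp_scope.
Local Notation "1" := gone : grp_scope.
Local Notation "x ^ n" := (zpow x n%Z) : grp_scope.

(** * Groups *)

Section Groups.
Context {G : Group}.
Implicit Types (x y z g h : G) (m n : Z).

Lemma gmulA x y z : (x * y) * z = x * (y * z).
Proof. symmetry; apply gassoc. Qed.

Lemma gmulKV x y : x^-1 * (x * y) = y.
Proof. now rewrite gassoc, ginv_l, gone_l. Qed.

Lemma gmul_cancel_l x y z : x * y = x * z -> y = z.
Proof. intros H; rewrite <- (gmulKV x y), H; apply gmulKV. Qed.

Lemma gmul1 x : x * 1 = x.
Proof. apply (gmul_cancel_l x^-1); now rewrite gmulKV, ginv_l. Qed.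

Lemma gmulV x : x * x^-1 = 1.
Proof. apply (gmul_cancel_l x^-1); now rewrite gmulKV, gmul1. Qed.

Lemma gmulK x y : x * (x^-1 * y) = y.
Proof. now rewrite gassoc, gmulV, gone_l. Qed.

Lemma ginv_unique x y : x * y = 1 -> y = x^-1.
Proof. intros H; apply (gmul_cancel_l x); now rewrite H, gmulV. Qed.

Lemma ginvK x : (x^-1)^-1 = x.
Proof. symmetry; apply ginv_unique, ginv_l. Qed.

Lemma ginv1 : (1 : G)^-1 = 1.
Proof. symmetry; apply ginv_unique, gone_l. Qed.

Lemma ginvM x y : (x * y)^-1 = y^-1 * x^-1.
Proof. symmetry; apply ginv_unique; now rewrite gmulA, gmulK, gmulV. Qed.

End Groups.

#[global] Hint Rewrite @gmulA @gone_l @gmul1 @ginv_l @gmulV @gmulKV @gmulK @ginvK @ginv1 @ginvM : grp.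
Ltac grp := autorewrite with grp; try reflexivity.

Section Powers.
Context {G : Group}.
Implicit Types (x y z g h : G) (m n : Z).

Lemma gmul_cancel_r x y z : y * x = z * x -> y = z.
Proof.
  intros H; replace y with ((y * x) * x^-1) by grp; rewrite H; grp.
Qed.

Lemma npow_comm x k : x * npow x k = npow x k * x.
Proof. induction k as [|k IH]; simpl; grp; now rewrite IH at 1. Qed.

Lemma zpow_of_nat x k : x ^ (Z.of_nat k) = npow x k.
Proof.
  destruct k as [|k]; [reflexivity|]; simpl zpow.
  now rewrite SuccNat2Pos.id_succ.
Qed.

Lemma zpow_opp_of_nat x k : x ^ (- Z.of_nat k) = (npow x k)^-1.
Proof.
  destruct k as [|k]; [simpl; grp|]; simpl Z.of_nat; simpl Z.opp; cbn [zpow].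
  now rewrite SuccNat2Pos.id_succ.
Qed.

Lemma Z_of_nat_or_opp n : exists k, n = Z.of_nat k \/ n = (- Z.of_nat (S k))%Z.
Proof.
  destruct (Z_lt_le_dec n 0).
  - exists (Z.to_nat (- n - 1)); right; lia.
  - exists (Z.to_nat n); left; lia.
Qed.

Lemma zpow_succ x n : x ^ (n + 1) = x * x ^ n.
Proof.
  destruct (Z_of_nat_or_opp n) as [k [->| ->]].
  - replace (Z.of_nat k + 1)%Z with (Z.of_nat (S k)) by lia.
    now rewrite !zpow_of_nat.
  - replace (- Z.of_nat (S k) + 1)%Z with (- Z.of_nat k)%Z by lia.
    rewrite !zpow_opp_of_nat; simpl; rewrite npow_comm; grp.
Qed.

Lemma zpow_pred x n : x ^ (n - 1) = x^-1 * x ^ n.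
Proof.
  replace n with (n - 1 + 1)%Z at 2 by lia; rewrite zpow_succ; grp.
Qed.

Lemma zpow0 x : x ^ 0 = 1.
Proof. reflexivity. Qed.

Lemma zpow1 x : x ^ 1 = x.
Proof. simpl; grp. Qed.

Lemma Z_ind_both (P : Z -> Prop) :
  P 0%Z -> (forall n, P n -> P (n + 1)%Z) -> (forall n, P n -> P (n - 1)%Z) ->
  forall n, P n.
Proof. intros H0 HS HP; apply Z.peano_ind; auto. Qed.

Lemma zpow_add x m n : x ^ (m + n) = x ^ m * x ^ n.
Proof.
  revert m; apply Z_ind_both.
  - simpl; grp.
  - intros m IH; replace (m + 1 + n)%Z with (m + n + 1)%Z by lia.
    rewrite !zpow_succ, IH; grp.
  - intros m IH; replace (m - 1 + n)%Z with (m + n - 1)%Z by lia.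
    rewrite !zpow_pred, IH; grp.
Qed.

Lemma zpow_opp x n : x ^ (- n) = (x ^ n)^-1.
Proof.
  apply ginv_unique; rewrite <- zpow_add.
  now replace (n + - n)%Z with 0%Z by lia.
Qed.

Lemma zpow_sub x m n : x ^ (m - n) = x ^ m * (x ^ n)^-1.
Proof. now unfold Z.sub; rewrite zpow_add, zpow_opp. Qed.

Lemma zpow_mul x m n : x ^ (m * n) = (x ^ m) ^ n.
Proof.
  revert n; apply Z_ind_both.
  - now rewrite Z.mul_0_r.
  - intros n IH; replace (m * (n + 1))%Z with (m + m * n)%Z by lia.
    now rewrite zpow_add, zpow_succ, IH.
  - intros n IH; replace (m * (n - 1))%Z with (- m + m * n)%Z by lia.
    now rewrite zpow_add, zpow_pred, IH, zpow_opp.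
Qed.

Lemma zpow_one n : (1 : G) ^ n = 1.
Proof.
  revert n; apply Z_ind_both; [reflexivity| |]; intros n IH.
  - rewrite zpow_succ, IH; grp.
  - rewrite zpow_pred, IH; grp.
Qed.

Lemma zpow_commute x m n : x ^ m * x ^ n = x ^ n * x ^ m.
Proof. now rewrite <- !zpow_add, Z.add_comm. Qed.

Lemma zpow_conj g x n : (g * x * g^-1) ^ n = g * x ^ n * g^-1.
Proof.
  revert n; apply Z_ind_both.
  - simpl; grp.
  - intros n IH; rewrite !zpow_succ, IH; grp.
  - intros n IH; rewrite !zpow_pred, IH; grp.
Qed.

Definition commute x y := x * y = y * x.

Lemma commute_conj x y : x * y * x^-1 = y <-> commute x y.
Proof.
  unfold commute; split; intros H.
  - apply (gmul_cancel_r x^-1); rewrite H; grp.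
  - rewrite H; grp.
Qed.

Lemma commute_sym x y : commute x y -> commute y x.
Proof. now unfold commute. Qed.

Lemma commute_mul x y z : commute x y -> commute x z -> commute x (y * z).
Proof.
  unfold commute; intros H1 H2; rewrite gassoc, H1, gmulA, H2; grp.
Qed.

Lemma commute_inv x y : commute x y -> commute x y^-1.
Proof.
  unfold commute; intros H; apply (gmul_cancel_l y); rewrite gassoc, <- H; grp.
Qed.

Lemma commute_zpow x y n : commute x y -> commute x (y ^ n).
Proof.
  intros H; apply commute_conj; rewrite <- zpow_conj.
  now apply commute_conj in H; rewrite H.
Qed.

Lemma zpow_mul_commute x y n : commute x y -> (x * y) ^ n = x ^ n * y ^ n.
Proof.
  intros H; assert (E : forall m, x * y ^ m = y ^ m * x)
    by (intros m; now apply commute_zpow).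
  revert n; apply Z_ind_both.
  - simpl; grp.
  - intros n IH; rewrite !zpow_succ, IH; rewrite (gmulA x y), (gassoc _ y (x ^ n)).
    replace (y * x ^ n) with (x ^ n * y); [grp|].
    symmetry; apply commute_zpow; now apply commute_sym.
  - intros n IH; rewrite !zpow_pred, IH; rewrite ginvM.
    rewrite (gmulA y^-1), (gassoc _ x^-1 (x^n)).
    replace (x^-1 * x ^ n) with (x ^ (n - 1)) by apply zpow_pred.
    rewrite !gassoc; f_equal.
    symmetry; apply (commute_sym y^-1); apply commute_zpow.
    apply commute_sym, commute_inv; exact H.
Qed.

Lemma subgroup_zpow (K : G -> Prop) x n : subgroup K -> K x -> K (x ^ n).
Proof.
  intros [H1 [HM HV]] Hx; revert n; apply Z_ind_both; [exact H1| |]; intros n IH.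
  - rewrite zpow_succ; auto.
  - rewrite zpow_pred; auto.
Qed.

Lemma subgroup_inter (K L : G -> Prop) :
  subgroup K -> subgroup L -> subgroup (fun x => K x /\ L x).
Proof. unfold subgroup; firstorder. Qed.

End Powers.

Section Homomorphisms.
Context {G H : Group}.

Lemma hom1 (f : G -> H) : is_hom f -> f 1 = 1.
Proof.
  intros Hf; apply (gmul_cancel_l (f 1)); rewrite <- Hf; grp.
Qed.

Lemma homV (f : G -> H) x : is_hom f -> f x^-1 = (f x)^-1.
Proof.
  intros Hf; apply ginv_unique; rewrite <- Hf, gmulV; now apply hom1.
Qed.

Definition hom_on (K : G -> Prop) (f : G -> H) :=
  forall x y, K x -> K y -> f (x * y) = f x * f y.

Lemma hom_on1 (K : G -> Prop) (f : G -> H) : subgroup K -> hom_on K f -> f 1 = 1.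
Proof.
  intros HK Hf; apply (gmul_cancel_l (f 1)).
  rewrite <- Hf by apply HK; grp.
Qed.

Lemma hom_onV (K : G -> Prop) (f : G -> H) x :
  subgroup K -> hom_on K f -> K x -> f x^-1 = (f x)^-1.
Proof.
  intros HK Hf Hx; apply ginv_unique; rewrite <- Hf; trivial.
  - rewrite gmulV; now apply (hom_on1 K).
  - now apply HK.
Qed.

Lemma hom_on_zpow (K : G -> Prop) (f : G -> H) x n :
  subgroup K -> hom_on K f -> K x -> f (x ^ n) = f x ^ n.
Proof.
  intros HK Hf Hx; revert n; apply Z_ind_both.
  - now apply (hom_on1 K).
  - intros n IH; rewrite !zpow_succ, Hf, IH; auto; now apply subgroup_zpow.
  - intros n IH; rewrite !zpow_pred, Hf, IH, (hom_onV K); auto; [|now apply subgroup_zpow].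
    now apply HK.
Qed.

Lemma hom_zpow (f : G -> H) x n : is_hom f -> f (x ^ n) = f x ^ n.
Proof.
  intros Hf; apply (hom_on_zpow (fun _ => True)); firstorder.
Qed.

End Homomorphisms.

(** * Consequences of unique roots for commuting elements *)

Section UniqueRoots.
Context {G : Group}.
Hypothesis UR : unique_root G.
Implicit Types (x y z g h c : G) (m n : Z).

Lemma unique_zroot x y n : n <> 0%Z -> x ^ n = y ^ n -> x = y.
Proof.
  intros Hn; destruct (Z_of_nat_or_opp n) as [k [->| ->]].
  - rewrite !zpow_of_nat; apply UR; lia.
  - rewrite !zpow_opp_of_nat; intros E; apply (UR x y (S k)); [lia|].
    now rewrite <- (ginvK (npow x _)), E, ginvK.
Qed.

(** The conjugate of [y] by [x] has the same [n]-th power as [y], hence equals [y]. *)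
Lemma commute_of_zpow_r x y n : n <> 0%Z -> commute x (y ^ n) -> commute x y.
Proof.
  intros Hn; rewrite <- !commute_conj, <- zpow_conj; now apply unique_zroot.
Qed.

Lemma commute_of_common_power x y c m n a b :
  m <> 0%Z -> n <> 0%Z -> x ^ m = c ^ a -> y ^ n = c ^ b -> commute x y.
Proof.
  intros Hm Hn Hx Hy; apply (commute_of_zpow_r _ _ n Hn); rewrite Hy.
  apply commute_sym, (commute_of_zpow_r _ _ m Hm); rewrite Hx; apply zpow_commute.
Qed.

End UniqueRoots.

(** * Commensurations with domain of index prime to p *)

Section CoprimeDense.
Context {G : Group}.
Implicit Types (K L M : G -> Prop) (x y : G).

Lemma not_NoDup_map {T : Type} (r : nat -> T) k :
  ~ NoDup (map r (seq 0 k)) -> exists i j, (i < j < k)%nat /\ r i = r j.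
Proof.
  intros H; apply NNPP; intros Hn; apply H.
  apply Injective_map_NoDup_in; [|apply seq_NoDup].
  intros i j Hi Hj E; apply in_seq in Hi, Hj.
  destruct (Nat.lt_trichotomy i j) as [Hl|[Hl|Hl]]; trivial; exfalso; apply Hn.
  - exists i, j; split; [lia|easy].
  - exists j, i; split; [lia|easy].
Qed.

(** Pigeonhole: two of the powers [x^0, .., x^(length reps)] share a coset representative. The bound
    on the exponent is what later makes it prime to [p]. *)
Lemma finite_index_zpow K (reps : list G) :
  subgroup K ->
  (forall g, exists r, In r reps /\ K (r^-1 * g)) ->
  forall x, exists m, (1 <= m <= Z.of_nat (length reps))%Z /\ K (x ^ m).
Proof.
  intros HK Hreps x.
  destruct (constructive_indefinite_description
    (fun r : nat -> G => forall k, In (r k) reps /\ K ((r k)^-1 * x ^ Z.of_nat k)))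
    as [r Hr].
  { exists (fun k => epsilon (inhabits 1)
      (fun r => In r reps /\ K (r^-1 * x ^ Z.of_nat k))).
    intros k; apply epsilon_spec, Hreps. }
  destruct (not_NoDup_map r (S (length reps))) as [i [j [Hij E]]].
  { intros Hnd; apply NoDup_incl_length with (l' := reps) in Hnd.
    - rewrite length_map, length_seq in Hnd; lia.
    - intros y Hy; apply in_map_iff in Hy as [k [<- _]]; apply Hr. }
  exists (Z.of_nat j - Z.of_nat i)%Z; split; [lia|].
  replace (x ^ (Z.of_nat j - Z.of_nat i)) with
    (((r i)^-1 * x ^ Z.of_nat i)^-1 * ((r j)^-1 * x ^ Z.of_nat j)).
  - apply HK; [apply HK|]; apply Hr.
  - rewrite E; grp; rewrite <- zpow_opp, <- zpow_add; f_equal; lia.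
Qed.

(* Stands in for finite index: it is stable under intersections and, unlike
   the index, is trivially transported by partial isomorphisms. *)
Definition power_dense M := forall x, exists m, m <> 0%Z /\ M (x ^ m).

(* Stands in for "the index of K has only small prime factors". *)
Definition coprime_dense (p : Z) K :=
  subgroup K /\ forall x, exists m, rel_prime m p /\ K (x ^ m).

Lemma finite_index_power_dense K : finite_index K -> power_dense K.
Proof.
  intros [HK [reps Hr]] x; destruct (finite_index_zpow K reps HK Hr x) as [m [Hm H]].
  exists m; split; [lia|exact H].
Qed.

Lemma power_dense_inter K L :
  subgroup K -> power_dense K -> power_dense L -> power_dense (fun x => K x /\ L x).
Proof.
  intros HK DK DL x; destruct (DK x) as [m [Hm Km]].
  destruct (DL (x ^ m)) as [n [Hn Ln]]; exists (m * n)%Z.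
  rewrite zpow_mul; split; [lia|split; [|exact Ln]]; now apply subgroup_zpow.
Qed.

Lemma rel_prime_mult_l a b p : rel_prime a p -> rel_prime b p -> rel_prime (a * b) p.
Proof.
  intros Ha Hb; apply rel_prime_sym, rel_prime_mult; now apply rel_prime_sym.
Qed.

Lemma rel_prime_neq0 m p : (1 < p)%Z -> rel_prime m p -> m <> 0%Z.
Proof.
  intros Hp H ->; apply Zis_gcd_gcd in H; [|lia]; rewrite Z.gcd_0_l in H; lia.
Qed.

Lemma iso_on_hom_on K L f : iso_on K L f -> hom_on K f.
Proof. now intros [H _]. Qed.

(** A power of [x] lies in [K], and a further power has its image in [K']; the exponents multiply
    and stay prime to [p]. *)
Lemma coprime_dense_preimage p K L f K' :
  coprime_dense p K -> iso_on K L f -> coprime_dense p K' ->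
  coprime_dense p (fun x => K x /\ K' (f x)).
Proof.
  intros [HK DK] Hf [HK' DK']; pose proof (iso_on_hom_on _ _ _ Hf) as Hm.
  split.
  - split; [|split].
    + split; [apply HK|]; rewrite (hom_on1 K); trivial; apply HK'.
    + intros x y [Kx Kx'] [Ky Ky']; split; [now apply HK|].
      rewrite Hm by trivial; now apply HK'.
    + intros x [Kx Kx']; split; [now apply HK|].
      rewrite (hom_onV K) by trivial; now apply HK'.
  - intros x; destruct (DK x) as [m [Pm Km]]; destruct (DK' (f (x ^ m))) as [n [Pn Kn]].
    exists (m * n)%Z; rewrite zpow_mul; split; [now apply rel_prime_mult_l|].
    split; [now apply subgroup_zpow|]; now rewrite (hom_on_zpow K).
Qed.

(** A power of [y] in [L] is pulled back to [K], raised to a power in [K'], and mapped forward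
    again. *)
Lemma coprime_dense_image p K L f K' :
  coprime_dense p L -> iso_on K L f -> coprime_dense p K' -> subgroup K ->
  (forall x, K' x -> K x) ->
  coprime_dense p (fun y => exists x, K' x /\ y = f x).
Proof.
  intros [HL DL] Hf [HK' DK'] HK Hsub; pose proof (iso_on_hom_on _ _ _ Hf) as Hm.
  split.
  - split; [|split].
    + exists 1; split; [apply HK'|]; now rewrite (hom_on1 K).
    + intros _ _ [x [Kx ->]] [y [Ky ->]]; exists (x * y); split; [now apply HK'|].
      rewrite Hm; auto.
    + intros _ [x [Kx ->]]; exists (x^-1); split; [now apply HK'|].
      rewrite (hom_onV K); auto.
  - intros y; destruct (DL y) as [m [Pm Lm]].
    destruct Hf as (_ & _ & _ & Sf); destruct (Sf _ Lm) as [x [Kx Ex]].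
    destruct (DK' x) as [n [Pn Kn]].
    exists (m * n)%Z; split; [now apply rel_prime_mult_l|].
    exists (x ^ n); split; trivial.
    now rewrite (hom_on_zpow K), zpow_mul, Ex.
Qed.

(** Up to the equivalence in Comm(G), [f] represents [b]; [M] is where the two are known to agree.
    Nonzero exponents suffice for [M], because unique roots spread the agreement to all elements on
    which both maps are homomorphisms. *)
Definition has_coprime_dense_model (p : Z) (b : PIso G) :=
  exists K L f M,
    coprime_dense p K /\ coprime_dense p L /\ iso_on K L f /\
    subgroup M /\ power_dense M /\ forall x, M x -> K x /\ f x = pmap b x.

Lemma model_base p a :
  is_comm a -> coprime_dense p (pdom a) -> coprime_dense p (pcod a) ->
  has_coprime_dense_model p a.
Proof.
  intros (Fd & Fc & Hf) Dd Dc; exists (pdom a), (pcod a), (pmap a), (pdom a).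
  repeat split; try apply Dd; try apply Dc; try apply Hf; trivial.
  now apply finite_index_power_dense.
Qed.

Lemma model_id p : has_coprime_dense_model p (pid G).
Proof.
  assert (DT : coprime_dense p (fun _ : G => True)).
  { split; [firstorder|]; intros x; exists 1%Z; split; [apply rel_prime_1|easy]. }
  exists (fun _ => True), (fun _ => True), (fun x => x), (fun _ => True).
  split; [exact DT|split; [exact DT|]].
  split; [|split; [firstorder|split]].
  - repeat split; trivial; intros y _; now exists y.
  - intros x; now exists 1%Z.
  - easy.
Qed.

Lemma model_comp p a b :
  has_coprime_dense_model p a -> has_coprime_dense_model p b ->
  has_coprime_dense_model p (pcomp a b).
Proof.
  intros (K1 & L1 & f1 & M1 & DK1 & DL1 & I1 & S1 & P1 & E1)
         (K2 & L2 & f2 & M2 & DK2 & DL2 & I2 & S2 & P2 & E2).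
  pose proof (coprime_dense_preimage p K1 L1 f1 K2 DK1 I1 DK2) as DK.
  (* The codomain of the composite is obtained by taking images twice, so the intermediate group
     must itself be dense. *)
  assert (DI : coprime_dense p (fun y => exists x, (K1 x /\ K2 (f1 x)) /\ y = f1 x)).
  { apply (coprime_dense_image p K1 L1); trivial; [apply DK1|now intros x []]. }
  exists (fun x => K1 x /\ K2 (f1 x)),
    (fun z => exists y, (exists x, (K1 x /\ K2 (f1 x)) /\ y = f1 x) /\ z = f2 y),
    (fun x => f2 (f1 x)), (fun x => M1 x /\ M2 (f1 x)).
  split; [exact DK|split; [|split; [|split; [|split]]]].
  - apply (coprime_dense_image p K2 L2); trivial; [apply DK2|].
    intros y (x & [_ H] & ->); exact H.
  - destruct I1 as (h1 & c1 & i1 & s1), I2 as (h2 & c2 & i2 & s2).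
    split; [|split; [|split]].
    + intros x y [] []; now rewrite h1, h2.
    + intros x Hx; exists (f1 x); split; trivial; now exists x.
    + intros x y [] [] E; now apply i1, i2.
    + intros z (y & (x & Hx & ->) & ->); now exists x.
  - pose proof (iso_on_hom_on _ _ _ I1) as h1; destruct DK1 as [HK1 _].
    split; [|split].
    + split; [apply S1|]; rewrite (hom_on1 K1); trivial; apply S2.
    + intros x y [] []; split; [now apply S1|].
      rewrite h1; [now apply S2|now apply E1|now apply E1].
    + intros x []; split; [now apply S1|].
      rewrite (hom_onV K1); trivial; [now apply S2|now apply E1].
  - intros x; destruct (P1 x) as [m [Hm Mm]]; destruct (P2 (f1 (x ^ m))) as [n [Hn Mn]].
    exists (m * n)%Z; rewrite zpow_mul; split; [lia|split; [now apply subgroup_zpow|]].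
    rewrite (hom_on_zpow K1); trivial; [apply DK1|now apply iso_on_hom_on in I1|].
    now apply E1.
  - intros x [Hx1 Hx2]; destruct (E1 x Hx1) as [Kx Ex]; destruct (E2 _ Hx2) as [Ky Ey].
    split; [easy|]; simpl; now rewrite Ey, Ex.
Qed.

Lemma model_equiv p a b (M' : G -> Prop) :
  has_coprime_dense_model p a -> subgroup M' -> power_dense M' ->
  (forall x, M' x -> pmap a x = pmap b x) -> has_coprime_dense_model p b.
Proof.
  intros (K & L & f & M & DK & DL & I & S & P & E) S' P' E'.
  exists K, L, f, (fun x => M x /\ M' x).
  split; [exact DK|split; [exact DL|split; [exact I|split; [|split]]]].
  - now apply subgroup_inter.
  - now apply power_dense_inter.
  - intros x [Mx Mx']; destruct (E x Mx) as [Kx Ex]; split; trivial.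
    now rewrite Ex, E'.
Qed.

(** The inverse [g] of [f], chosen pointwise on [L], is a model: it agrees with [b] on the image
    under [f] of [M] intersected with [M'], since there [b] undoes [a]. *)
Lemma model_inv p a b (M' : G -> Prop) : (1 < p)%Z ->
  has_coprime_dense_model p a -> subgroup M' -> power_dense M' ->
  (forall x, M' x -> pmap b (pmap a x) = x) -> has_coprime_dense_model p b.
Proof.
  intros Hp (K & L & f & M & DK & DL & I & S & P & E) S' P' E'.
  set (g := fun y => epsilon (inhabits 1) (fun x => K x /\ f x = y)).
  assert (Hg : forall y, L y -> K (g y) /\ f (g y) = y).
  { intros y Ly; apply epsilon_spec; now apply I. }
  assert (Hgf : forall x, K x -> g (f x) = x).
  { intros x Kx; destruct I as (h & c & i & s); destruct (Hg (f x)); auto. }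
  pose proof (iso_on_hom_on _ _ _ I) as h; destruct DK as [HK DK].
  exists L, K, g, (fun y => exists x, (M x /\ M' x) /\ y = f x).
  split; [exact DL|split; [now split|split; [|split; [|split]]]].
  - split; [|split; [|split]].
    + intros y y' Ly Ly'; destruct (Hg y Ly) as [Kx Ex], (Hg y' Ly') as [Kx' Ex'].
      rewrite <- Ex, <- Ex' at 1; rewrite <- h by trivial.
      apply Hgf; now apply HK.
    + intros y Ly; now apply Hg.
    + intros y y' Ly Ly' Eg; destruct (Hg y Ly) as [_ <-], (Hg y' Ly') as [_ <-].
      now rewrite Eg.
    + intros x Kx; exists (f x); split; [now apply I|now apply Hgf].
  - split; [|split].
    + exists 1; split; [split; [apply S|apply S']|]; now rewrite (hom_on1 K).
    + intros _ _ (x & [Mx Mx'] & ->) (y & [My My'] & ->); exists (x * y).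
      split; [split; [now apply S|now apply S']|].
      symmetry; apply h; now apply E.
    + intros _ (x & [Mx Mx'] & ->); exists (x^-1).
      split; [split; [now apply S|now apply S']|].
      symmetry; apply (hom_onV K); trivial; now apply E.
  - intros y; destruct DL as [HL DL]; destruct (DL y) as [m [Pm Lm]].
    destruct (Hg _ Lm) as [Kx Ex].
    destruct (power_dense_inter M M' S P P' (g (y ^ m))) as [n [Hn Mn]].
    pose proof (rel_prime_neq0 m p Hp Pm).
    exists (m * n)%Z; split; [lia|]; exists (g (y ^ m) ^ n); split; trivial.
    now rewrite (hom_on_zpow K), Ex, zpow_mul.
  - intros _ (x & [Mx Mx'] & ->); destruct (E x Mx) as [Kx Ex].
    split; [now apply I|]; rewrite Hgf by trivial; rewrite Ex; symmetry; now apply E'.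
Qed.

(** The classes that have a model contain the identity and are closed under products and inverses,
    so they contain everything the generators generate. *)
Lemma comm_gen_model p (S : list (PIso G)) b : (1 < p)%Z ->
  (forall a, In a S -> has_coprime_dense_model p a) ->
  comm_gen S b -> has_coprime_dense_model p b.
Proof.
  intros Hp HS; induction 1 as [a Ha| |a b _ IHa _ IHb|a b _ IHa Hb (K & FK & E)
    |a b _ IHa Hb (K & FK & E)].
  - now apply HS.
  - apply model_id.
  - now apply model_comp.
  - apply (model_inv p a b K); trivial; [apply FK|now apply finite_index_power_dense|].
    intros x Kx; now apply E.
  - apply (model_equiv p a b K); trivial; [apply FK|now apply finite_index_power_dense|].
    intros x Kx; now apply E.
Qed.

End CoprimeDense.

(** * Twists of the cyclic covers of an HNN extension *)

Definition subgroup_group (G : Group) (P : G -> Prop) (HP : subgroup P) : Group.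
Proof.
  refine {| gcar := {x : G | P x};
    gmul := fun x y => exist P (proj1_sig x * proj1_sig y)
              (proj1 (proj2 HP) _ _ (proj2_sig x) (proj2_sig y));
    ginv := fun x => exist P (proj1_sig x)^-1 (proj2 (proj2 HP) _ (proj2_sig x));
    gone := exist P 1 (proj1 HP) |}.
  - intros x y z; apply subset_eq_compat; simpl; grp.
  - intros [x Hx]; apply subset_eq_compat; simpl; grp.
  - intros [x Hx]; apply subset_eq_compat; simpl; grp.
Defined.

(* The unrestricted wreath product of G by Z. *)
Definition shift_group (G : Group) : Group.
Proof.
  refine {| gcar := (Z * (Z -> G))%type;
    gmul := fun x y => ((fst x + fst y)%Z, fun n => snd x (n + fst y)%Z * snd y n);
    ginv := fun x => ((- fst x)%Z, fun n => (snd x (n - fst x)%Z)^-1);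
    gone := (0%Z, fun _ => 1) |}.
  - intros [k f] [l g] [m h]; simpl; f_equal; [lia|].
    apply functional_extensionality; intros n; grp.
    now replace (n + (l + m))%Z with (n + m + l)%Z by lia.
  - intros [k f]; simpl; f_equal; apply functional_extensionality; intros n; grp.
  - intros [k f]; simpl; f_equal; [lia|].
    apply functional_extensionality; intros n.
    replace (n + k - k)%Z with n by lia; grp.
Defined.

Section HNN.
Context {A G : Group} (C : A -> Prop) (phi : A -> A) (i : A -> G) (t : G).
Hypothesis HNN : is_HNN C phi i t.

Lemma HNN_hom : is_hom i.
Proof. apply HNN. Qed.

Lemma HNN_rel c : C c -> i c * t = t * i (phi c).
Proof.
  intros Hc; destruct HNN as (_ & H & _); rewrite <- H by trivial; grp.
Qed.

(** The universal property gives a homomorphism from [G] to the group [P]; followed by the inclusion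
    it fixes [i a] and [t], so by uniqueness it is the identity. *)
Lemma HNN_generated (P : G -> Prop) :
  subgroup P -> (forall a, P (i a)) -> P t -> forall g, P g.
Proof.
  intros HP Pi Pt g; destruct HNN as (hi & Ht & U).
  destruct (U (subgroup_group G P HP) (fun a => exist P (i a) (Pi a)) (exist P t Pt))
    as (f & hf & fi & ft & _).
  - intros a b; apply subset_eq_compat, hi.
  - intros c Hc; apply subset_eq_compat; simpl; auto.
  - destruct (U G i t hi Ht) as (f0 & _ & _ & _ & u).
    replace g with (proj1_sig (f g)); [apply proj2_sig|].
    rewrite (u (fun x => proj1_sig (f x))), (u (fun x => x)); trivial.
    + now intros x y.
    + intros x y; now rewrite hf.
    + intros a; now rewrite fi.
    + now rewrite ft.
Qed.

Record is_exponent (eps : G -> Z) : Prop := {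
  eps_mul : forall g h, eps (g * h) = (eps g + eps h)%Z;
  eps_base : forall a, eps (i a) = 0%Z;
  eps_t : eps t = 1%Z }.

(** [theta n] is the coordinate at [n] of a homomorphism into [shift_group G]. Words are read from
    right to left, starting at level [n] of the infinite cyclic cover, and each passage of [t] from
    level [m] to [m + 1] inserts [kappa m]. *)
Record is_twist (eps : G -> Z) (kappa : Z -> G) (theta : Z -> G -> G) : Prop := {
  twist_mul : forall n g h, theta n (g * h) = theta (n + eps h)%Z g * theta n h;
  twist_base : forall n a, theta n (i a) = i a;
  twist_t : forall n, theta n t = kappa n * t }.

(** The universal property is applied with the wreath product as target; the HNN relation survives
    there because every [kappa n] commutes with [i C]. *)
Lemma shift_hom_exists (kappa : Z -> G) :
  (forall n c, C c -> commute (kappa n) (i c)) ->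
  exists eps theta, is_exponent eps /\ is_twist eps kappa theta.
Proof.
  intros Hk; destruct HNN as (hi & Ht & U).
  destruct (U (shift_group G) (fun a => (0%Z, fun _ => i a))
    (1%Z, fun n => kappa n * t)) as (f & hf & fi & ft & _).
  - intros a b; simpl; f_equal; apply functional_extensionality; intros n; apply hi.
  - intros c Hc; simpl; f_equal; apply functional_extensionality; intros n.
    replace (n + 1 - 1)%Z with n by lia; rewrite <- (Ht c Hc); grp; f_equal.
    rewrite !gassoc; f_equal; rewrite gmulA, <- (Hk n c Hc); grp.
  - exists (fun g => fst (f g)), (fun n g => snd (f g) n); split; split.
    + intros g h; now rewrite hf.
    + intros a; now rewrite fi.
    + now rewrite ft.
    + intros n g h; now rewrite hf.
    + intros n a; now rewrite fi.
    + intros n; now rewrite ft.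
Qed.

Section Exponent.
Context (eps : G -> Z) (Heps : is_exponent eps).

Lemma eps1 : eps 1 = 0%Z.
Proof. pose proof (eps_mul _ Heps 1 1) as H; rewrite gone_l in H; lia. Qed.

Lemma epsV g : eps g^-1 = (- eps g)%Z.
Proof.
  pose proof (eps_mul _ Heps g g^-1) as H; rewrite gmulV, eps1 in H; lia.
Qed.

Lemma eps_zpow g n : eps (g ^ n) = (n * eps g)%Z.
Proof.
  revert n; apply Z_ind_both.
  - apply eps1.
  - intros n IH; rewrite zpow_succ, (eps_mul _ Heps), IH; lia.
  - intros n IH; rewrite zpow_pred, (eps_mul _ Heps), epsV, IH; lia.
Qed.

Lemma exponent_unique eps' : is_exponent eps' -> forall g, eps' g = eps g.
Proof.
  intros H'; apply HNN_generated.
  - split; [|split].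
    + apply eq_trans with 0%Z; [|symmetry; apply eps1].
      pose proof (eps_mul _ H' 1 1) as H; rewrite gone_l in H; lia.
    + intros x y Hx Hy; rewrite (eps_mul _ H'), (eps_mul _ Heps); lia.
    + intros x Hx; pose proof (eps_mul _ H' x x^-1) as H1.
      pose proof (eps_mul _ H' 1 1) as H2; rewrite gone_l in H2; rewrite gmulV in H1.
      rewrite epsV; lia.
  - intros a; now rewrite (eps_base _ H'), (eps_base _ Heps).
  - now rewrite (eps_t _ H'), (eps_t _ Heps).
Qed.

Lemma twist_exists (kappa : Z -> G) :
  (forall n c, C c -> commute (kappa n) (i c)) -> exists theta, is_twist eps kappa theta.
Proof.
  intros Hk; destruct (shift_hom_exists kappa Hk) as (eps' & theta & He & Ht).
  exists theta; split; try apply Ht; intros n g h.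
  rewrite <- (exponent_unique eps' He); apply Ht.
Qed.

Lemma twist1 kappa theta n : is_twist eps kappa theta -> theta n 1 = 1.
Proof.
  intros H; pose proof (twist_mul _ _ _ H n 1 1) as E.
  rewrite eps1, Z.add_0_r, gone_l in E.
  apply (gmul_cancel_l (theta n 1)); now rewrite <- E, gmul1.
Qed.

Lemma twistV kappa theta n g :
  is_twist eps kappa theta -> theta n g^-1 = (theta (n - eps g)%Z g)^-1.
Proof.
  intros H; apply ginv_unique; rewrite <- (twist1 kappa theta n H).
  rewrite <- (gmulV g), (twist_mul _ _ _ H), epsV; reflexivity.
Qed.

Lemma eps_twist kappa theta :
  is_twist eps kappa theta -> (forall n, eps (kappa n) = 0%Z) ->
  forall g n, eps (theta n g) = eps g.
Proof.
  intros H Hk; apply (HNN_generated (fun g => forall n, eps (theta n g) = eps g)).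
  - split; [|split].
    + intros n; now rewrite (twist1 _ _ _ H).
    + intros x y Hx Hy n.
      now rewrite (twist_mul _ _ _ H), !(eps_mul _ Heps), Hx, Hy.
    + intros x Hx n; now rewrite (twistV _ _ _ _ H), !epsV, Hx.
  - intros a n; now rewrite (twist_base _ _ _ H).
  - intros n; rewrite (twist_t _ _ _ H), (eps_mul _ Heps), Hk; lia.
Qed.

(** The identity is checked on generators. Preservation of [eps] by [theta] keeps the levels of both
    twists in step when passing to products. *)
Lemma twist_inverse (k : Z -> A) theta theta' :
  is_twist eps (fun n => i (k n)) theta -> is_twist eps (fun n => (i (k n))^-1) theta' ->
  forall g n, theta' n (theta n g) = g.
Proof.
  intros H H'.
  assert (Ek : forall g n, eps (theta n g) = eps g).
  { apply (eps_twist _ _ H); intros n; apply Heps. }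
  apply (HNN_generated (fun g => forall n, theta' n (theta n g) = g)).
  - split; [|split].
    + intros n; now rewrite (twist1 _ _ _ H), (twist1 _ _ _ H').
    + intros x y Hx Hy n.
      now rewrite (twist_mul _ _ _ H), (twist_mul _ _ _ H'), Ek, Hx, Hy.
    + intros x Hx n; now rewrite (twistV _ _ _ _ H), (twistV _ _ _ _ H'), Ek, Hx.
  - intros a n; now rewrite (twist_base _ _ _ H), (twist_base _ _ _ H').
  - intros n; rewrite (twist_t _ _ _ H), (twist_mul _ _ _ H'), (twist_base _ _ _ H').
    rewrite (twist_t _ _ _ H'); grp.
Qed.

Lemma twist_inverse' (k : Z -> A) theta theta' :
  is_twist eps (fun n => i (k n)) theta -> is_twist eps (fun n => (i (k n))^-1) theta' ->
  forall g n, theta n (theta' n g) = g.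
Proof.
  intros H H'; apply (twist_inverse (fun n => (k n)^-1)).
  - split; try apply H'; intros n; now rewrite homV by apply HNN_hom; apply H'.
  - split; try apply H; intros n; now rewrite homV, ginvK by apply HNN_hom; apply H.
Qed.

Lemma twist_periodic kappa theta p :
  is_twist eps kappa theta -> (forall n, kappa (n + p)%Z = kappa n) ->
  forall g n, theta (n + p)%Z g = theta n g.
Proof.
  intros H Hk; apply (HNN_generated (fun g => forall n, theta (n + p)%Z g = theta n g)).
  - split; [|split].
    + intros n; now rewrite !(twist1 _ _ _ H).
    + intros x y Hx Hy n; rewrite !(twist_mul _ _ _ H), Hy.
      replace (n + p + eps y)%Z with (n + eps y + p)%Z by lia; now rewrite Hx.
    + intros x Hx n; rewrite !(twistV _ _ _ _ H).
      replace (n + p - eps x)%Z with (n - eps x + p)%Z by lia; now rewrite Hx.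
  - intros a n; now rewrite !(twist_base _ _ _ H).
  - intros n; now rewrite !(twist_t _ _ _ H), Hk.
Qed.

Lemma twist_period_mul kappa theta p :
  is_twist eps kappa theta -> (forall n, kappa (n + p)%Z = kappa n) ->
  forall m n g, theta (n + m * p)%Z g = theta n g.
Proof.
  intros H Hk m n g; revert m; apply Z_ind_both.
  - now rewrite Z.add_0_r.
  - intros m IH; rewrite <- IH, <- (twist_periodic kappa theta p H Hk g (n + m * p)).
    f_equal; lia.
  - intros m IH; rewrite <- IH, <- (twist_periodic kappa theta p H Hk g (n + (m - 1) * p)).
    f_equal; lia.
Qed.

(** The group [G_p], kernel of the exponent sum modulo [p]. *)
Definition cover (p : Z) (g : G) := (p | eps g)%Z.

Lemma cover_subgroup p : subgroup (cover p).
Proof.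
  unfold cover; split; [|split].
  - rewrite eps1; apply Z.divide_0_r.
  - intros x y Hx Hy; rewrite (eps_mul _ Heps); now apply Z.divide_add_r.
  - intros x Hx; rewrite epsV; now apply Z.divide_opp_r.
Qed.

Lemma cover_finite_index p : (0 < p)%Z -> finite_index (cover p).
Proof.
  intros Hp; split; [apply cover_subgroup|].
  exists (map (fun k => t ^ Z.of_nat k) (seq 0 (Z.to_nat p))); intros g.
  exists (t ^ (eps g mod p)); pose proof (Z.mod_pos_bound (eps g) p Hp); split.
  - apply in_map_iff; exists (Z.to_nat (eps g mod p)); split.
    + f_equal; lia.
    + apply in_seq; lia.
  - unfold cover; rewrite (eps_mul _ Heps), epsV, eps_zpow, (eps_t _ Heps).
    exists (eps g / p)%Z; pose proof (Z.div_mod (eps g) p); lia.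
Qed.

(** The cocycle law shifts the level by [eps y], a multiple of the period. *)
Lemma twist_hom_on_cover kappa theta p :
  is_twist eps kappa theta -> (forall n, kappa (n + p)%Z = kappa n) ->
  hom_on (cover p) (theta 0%Z).
Proof.
  intros H Hk x y Hx [m Hm]; rewrite (twist_mul _ _ _ H), Hm.
  now rewrite (twist_period_mul kappa theta p H Hk m 0).
Qed.

Lemma twist_t_zpow kappa theta n (k : nat) :
  is_twist eps kappa theta ->
  (forall m, (n <= m < n + Z.of_nat k)%Z -> kappa m = 1) ->
  theta n (t ^ Z.of_nat k) = t ^ Z.of_nat k.
Proof.
  intros H; induction k as [|k IH]; intros Hk; [apply (twist1 _ _ _ H)|].
  rewrite Nat2Z.inj_succ, <- Z.add_1_r, zpow_succ, (twist_mul _ _ _ H).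
  rewrite eps_zpow, (eps_t _ Heps), Z.mul_1_r, (twist_t _ _ _ H), Hk, IH by
    (try intros; try apply Hk; lia).
  grp.
Qed.

(** Read from right to left, the word descends from level [n] to [n - k] and climbs back, so it
    meets only the edges [n - k, .., n - 1]. *)
Lemma twist_conj_zpow kappa theta n (k : nat) a :
  is_twist eps kappa theta ->
  (forall m, (n - Z.of_nat k <= m < n)%Z -> kappa m = 1) ->
  theta n (t ^ Z.of_nat k * i a * (t ^ Z.of_nat k)^-1)
    = t ^ Z.of_nat k * i a * (t ^ Z.of_nat k)^-1.
Proof.
  intros H Hk; rewrite (twist_mul _ _ _ H), (twist_mul _ _ _ H (n + _)%Z), (twistV _ _ _ _ H).
  rewrite (eps_base _ Heps), epsV, eps_zpow, (eps_t _ Heps), (twist_base _ _ _ H).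
  replace (n + - (Z.of_nat k * 1) + 0)%Z with (n - Z.of_nat k)%Z by lia.
  replace (n - Z.of_nat k * 1)%Z with (n - Z.of_nat k)%Z by lia.
  rewrite (twist_t_zpow _ _ _ _ H); trivial; intros m Hm; apply Hk; lia.
Qed.

End Exponent.
End HNN.

(* Some t^m with m prime to p lies in the domain of the model, so conjugation by
   t can be recovered there up to powers of t^p, and roots are unique. *)
Lemma coprime_dense_model_extends {G : Group} (p : Z) (N : G -> Prop) (t : G) (b : PIso G) :
  unique_root G -> (1 < p)%Z -> subgroup N -> hom_on N (pmap b) ->
  (forall h, N h -> N (t * h * t^-1)) -> (forall h, N h -> N (t^-1 * h * t)) ->
  N (t ^ p) -> has_coprime_dense_model p b ->
  exists z, z ^ p = pmap b (t ^ p) /\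
    forall h, N h -> pmap b (t * h * t^-1) = z * pmap b h * z^-1.
Proof.
  intros UR Hp HN hT N1 N2 Np (K & L & f & M & [HK DK] & _ & I & SM & PM & E).
  pose proof (iso_on_hom_on _ _ _ I) as hf; set (T := pmap b) in *.
  (* Both maps agree on a power of [x] lying in [M], and roots are unique. *)
  assert (fT : forall x, K x -> N x -> f x = T x).
  { intros x Kx Nx; destruct (PM x) as [m [Hm Mx]]; apply (unique_zroot UR _ _ m Hm).
    rewrite <- (hom_on_zpow K f), <- (hom_on_zpow N T); trivial; now apply E. }
  assert (Nt : forall n h, N h -> N (t ^ n * h * (t ^ n)^-1)).
  { intros n; pattern n; apply Z_ind_both; clear n.
    - intros h Nh; simpl; autorewrite with grp; exact Nh.
    - intros n IH h Nh; rewrite zpow_succ.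
      replace (_ * h * _) with (t * (t ^ n * h * (t ^ n)^-1) * t^-1) by grp; auto.
    - intros n IH h Nh; rewrite zpow_pred.
      replace (_ * h * _) with (t^-1 * (t ^ n * h * (t ^ n)^-1) * t) by grp; auto. }
  destruct (DK t) as [m [Pm Km]]; pose proof (rel_prime_neq0 m p Hp Pm) as Hm.
  destruct (rel_prime_bezout _ _ Pm) as [u v Huv].
  set (y := f (t ^ m)); set (P := T (t ^ p)).
  assert (EyP : y ^ p = P ^ m).
  { unfold y, P; rewrite <- (hom_on_zpow K f), <- (hom_on_zpow N T) by trivial.
    rewrite <- !zpow_mul, (Z.mul_comm p); apply fT.
    - rewrite zpow_mul; now apply subgroup_zpow.
    - rewrite Z.mul_comm, zpow_mul; now apply subgroup_zpow. }
  assert (CyP : commute P y).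
  { apply commute_sym, (commute_of_zpow_r UR _ _ m Hm); rewrite <- EyP.
    now apply commute_zpow. }
  (* With [u m + v p = 1], [t] is the product of [t^(p v)] and [t^(u m)]; [z] is the product of
     their images under [T] and [f]. *)
  exists (P ^ v * y ^ u); split.
  - rewrite zpow_mul_commute.
    + rewrite <- !zpow_mul, (Z.mul_comm u), (zpow_mul y), EyP, <- zpow_mul, <- zpow_add.
      replace (v * p + m * u)%Z with 1%Z by lia; apply zpow1.
    + apply commute_zpow, commute_sym, commute_zpow, commute_sym, CyP.
  - intros h Nh; destruct (DK h) as [e [Pe Ke]].
    pose proof (rel_prime_neq0 e p Hp Pe) as He.
    assert (Kk : K (t ^ (u * m))) by (rewrite Z.mul_comm, zpow_mul; now apply subgroup_zpow).
    assert (fk : f (t ^ (u * m)) = y ^ u)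
      by (now rewrite Z.mul_comm, zpow_mul, (hom_on_zpow K f)).
    (* The exponent [e] brings [h] into [K], where [f] is multiplicative; the root is then
       removed. *)
    assert (E1 : T (t ^ (u * m) * h * (t ^ (u * m))^-1) = y ^ u * T h * (y ^ u)^-1).
    { apply (unique_zroot UR _ _ e He).
      rewrite <- (hom_on_zpow N T) by auto; rewrite !zpow_conj.
      assert (Ne : N (h ^ e)) by now apply subgroup_zpow.
      rewrite <- fT; [|now repeat apply HK|auto].
      rewrite !hf, (hom_onV K f), fk, fT, (hom_on_zpow N T); trivial; now apply HK. }
    (* The same conjugate, now computed inside [N] from [t^(u m) = t^(-p v) t]. *)
    assert (E2 : T (t ^ (u * m) * h * (t ^ (u * m))^-1)
                 = (P ^ v)^-1 * T (t * h * t^-1) * P ^ v).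
    { replace (u * m)%Z with (- (p * v) + 1)%Z by lia.
      rewrite zpow_add, zpow1, zpow_opp, zpow_mul.
      assert (Nv : N ((t ^ p) ^ v)) by now apply subgroup_zpow.
      replace (_ * h * _) with (((t ^ p) ^ v)^-1 * (t * h * t^-1) * (t ^ p) ^ v) by grp.
      assert (Nv' : N ((t ^ p) ^ v)^-1) by now apply HN.
      rewrite hT, hT, (hom_onV N T), (hom_on_zpow N T); auto; now apply HN; auto. }
    rewrite E1 in E2.
    replace (T (t * h * t^-1)) with (P ^ v * ((P ^ v)^-1 * T (t * h * t^-1) * P ^ v) * (P ^ v)^-1)
      by grp.
    rewrite <- E2; grp.
Qed.

(** * The Dehn twist of the cover and the root it would force *)

Section TwistModel.
Context {A G : Group} (C : A -> Prop) (phi : A -> A) (i : A -> G) (t : G).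
Hypothesis HNN : is_HNN C phi i t.
Hypothesis UR : unique_root G.
Context (eps : G -> Z) (Heps : is_exponent i t eps).

Definition edge_twist (p : Z) (c : A) (n : Z) : A := if (n mod p =? 0)%Z then c else 1.

Lemma edge_twist_periodic p c n : (0 < p)%Z -> edge_twist p c (n + p) = edge_twist p c n.
Proof.
  intros Hp; unfold edge_twist.
  replace (n + p)%Z with (n + 1 * p)%Z by lia; now rewrite Z.mod_add by lia.
Qed.

Lemma edge_twist_trivial p c n m :
  (m * p < n < (m + 1) * p)%Z -> edge_twist p c n = 1.
Proof.
  intros H; unfold edge_twist.
  replace n with (n - m * p + m * p)%Z by lia; rewrite Z.mod_add by lia.
  rewrite Z.mod_small by lia; destruct (Z.eqb_spec (n - m * p) 0); [lia|reflexivity].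
Qed.

Lemma edge_twist_is_comm p c theta theta' : (0 < p)%Z ->
  is_twist i t eps (fun n => i (edge_twist p c n)) theta ->
  is_twist i t eps (fun n => (i (edge_twist p c n))^-1) theta' ->
  is_comm {| pdom := cover eps p; pcod := cover eps p; pmap := theta 0%Z |}.
Proof.
  intros Hp H H'.
  pose proof (twist_inverse C phi i t HNN eps Heps _ _ _ H H') as I.
  pose proof (twist_inverse' C phi i t HNN eps Heps _ _ _ H H') as I'.
  assert (Ee : forall g n, eps (theta n g) = eps g).
  { apply (eps_twist C phi i t HNN eps Heps _ _ H); intros n; apply Heps. }
  assert (Ee' : forall g n, eps (theta' n g) = eps g).
  { intros g n; now rewrite <- (I' g n) at 2; rewrite Ee. }
  pose proof (cover_finite_index i t eps Heps p Hp) as F.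
  split; [exact F|split; [exact F|split; [|split; [|split]]]]; simpl.
  - apply (twist_hom_on_cover C phi i t HNN eps Heps _ _ _ H).
    intros n; now rewrite edge_twist_periodic.
  - intros x; unfold cover; now rewrite Ee.
  - intros x y _ _ E; now rewrite <- (I x 0%Z), E, I.
  - intros y Hy; exists (theta' 0%Z y); split; [|apply I'].
    unfold cover; now rewrite Ee'.
Qed.

Definition centralizes (g : G) := forall a, commute g (i a).

Lemma centralizes_cancel_r g h : centralizes (g * h) -> centralizes h -> centralizes g.
Proof.
  intros Hg Hh a; replace g with ((g * h) * h^-1) by grp.
  apply commute_sym, commute_mul; [|apply commute_inv]; now apply commute_sym.
Qed.

Lemma conj_eq_commute (g h a : G) : g * a * g^-1 = h * a * h^-1 -> commute (g^-1 * h) a.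
Proof.
  intros E; apply commute_conj; autorewrite with grp.
  replace (g^-1 * _) with (g^-1 * (h * a * h^-1) * g) by grp; rewrite <- E; grp.
Qed.

Lemma edge_twist_root p c theta : (3 < p)%Z ->
  is_twist i t eps (fun n => i (edge_twist p c n)) theta ->
  has_coprime_dense_model p
    {| pdom := cover eps p; pcod := cover eps p; pmap := theta 0%Z |} ->
  exists w, (t * w) ^ p = t ^ (p - 1) * i c * t /\
    centralizes w /\ centralizes (t^-1 * w * t) /\ centralizes (t ^ (-2) * w * t ^ 2).
Proof.
  intros Hp H Hm.
  pose proof (cover_subgroup i t eps Heps p) as HN.
  pose proof (eps_mul _ _ _ Heps) as em; pose proof (epsV _ _ _ Heps) as ev.
  pose proof (eps_t _ _ _ Heps) as et; pose proof (eps_base _ _ _ Heps) as eb.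
  destruct (coprime_dense_model_extends p (cover eps p) t
    {| pdom := cover eps p; pcod := cover eps p; pmap := theta 0%Z |} UR ltac:(lia) HN)
    as (z & Ez & Cz); trivial.
  { simpl; apply (twist_hom_on_cover C phi i t HNN eps Heps _ _ _ H).
    intros n; rewrite edge_twist_periodic; [reflexivity|lia]. }
  { unfold cover; intros h; rewrite !em, ev, et; now replace (1 + _ + _)%Z with (eps h) by lia. }
  { unfold cover; intros h; rewrite !em, ev, et; now replace (_ + _ + 1)%Z with (eps h) by lia. }
  { unfold cover; rewrite (eps_zpow i t eps Heps), et, Z.mul_1_r; apply Z.divide_refl. }
  simpl in Ez, Cz.
  (* The left side is fixed by the twist, as the levels [-k, .., -1] contain no multiple of [p];
     iterating the conjugation rule for [z] turns its image into the right side. *)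
  assert (conj : forall (k : nat) a, (Z.of_nat k < p)%Z ->
    t ^ Z.of_nat k * i a * (t ^ Z.of_nat k)^-1 = z ^ Z.of_nat k * i a * (z ^ Z.of_nat k)^-1).
  { intros k a Hk; rewrite <- (twist_conj_zpow i t eps Heps _ _ 0 k a H).
    - clear Hk; induction k as [|k IH].
      + cbn [Z.of_nat zpow]; autorewrite with grp; apply H.
      + rewrite Nat2Z.inj_succ, <- Z.add_1_r, !zpow_succ.
        replace (_ * i a * _) with (t * (t ^ Z.of_nat k * i a * (t ^ Z.of_nat k)^-1) * t^-1)
          by grp.
        rewrite Cz, IH; [grp|].
        unfold cover; rewrite !em, ev, eb.
        replace (_ + _)%Z with 0%Z by lia; apply Z.divide_0_r.
    - intros m Hm'; rewrite (edge_twist_trivial p c m (-1)); [|lia].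
      apply hom1, (HNN_hom C phi i t HNN). }
  exists (t^-1 * z).
  assert (c1 : centralizes (t^-1 * z)).
  { intros a; pose proof (conj_eq_commute _ _ _ (conj 1%nat a ltac:(lia))) as E.
    change (Z.of_nat 1) with 1%Z in E; now rewrite !zpow1 in E. }
  (* With [w = t^-1 z], [t^-2 z^2] is [(t^-1 w t) w]; likewise [t^-3 z^3] below is
     [(t^-2 w t^2) (t^-1 w t) w], which is why [p > 3] is assumed. *)
  assert (c2 : centralizes (t^-1 * (t^-1 * z) * t)).
  { apply (centralizes_cancel_r _ (t^-1 * z)); [|exact c1].
    intros a; pose proof (conj_eq_commute _ _ _ (conj 2%nat a ltac:(lia))) as E.
    change (Z.of_nat 2) with (1 + 1)%Z in E; rewrite !zpow_succ, !zpow1 in E.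
    autorewrite with grp in *; exact E. }
  split; [|split; [exact c1|split; [exact c2|]]].
  - rewrite gmulK, Ez.
    (* The rightmost [t] crosses level 0 and picks up [c]; the other [p - 1] cross levels
       [1, .., p - 1], where the twist is trivial. *)
    replace p with (p - 1 + 1)%Z at 1 by lia; rewrite zpow_add, zpow1.
    rewrite (twist_mul _ _ _ _ _ H), et, (twist_t _ _ _ _ _ H).
    replace (p - 1)%Z with (Z.of_nat (Z.to_nat (p - 1))) by lia.
    rewrite (twist_t_zpow i t eps Heps _ _ _ _ H).
    + unfold edge_twist; rewrite Z.mod_0_l by lia; simpl; grp.
    + intros m Hm'; rewrite (edge_twist_trivial p c m 0); [|lia].
      apply hom1, (HNN_hom C phi i t HNN).
  - apply (centralizes_cancel_r _ (t^-1 * (t^-1 * z) * t * (t^-1 * z))).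
    + intros a; pose proof (conj_eq_commute _ _ _ (conj 3%nat a ltac:(lia))) as E.
      change (Z.of_nat 3) with (1 + 1 + 1)%Z in E.
      change (-2)%Z with (- (1 + 1))%Z; change 2%Z with (1 + 1)%Z.
      rewrite zpow_opp; rewrite !zpow_succ, !zpow1 in *.
      autorewrite with grp in *; exact E.
    + intros a; apply commute_sym, commute_mul; apply commute_sym; [apply c2|apply c1].
Qed.

End TwistModel.

(** * Normal forms in HNN extensions *)

(** Each permutation carries its inverse, so inverting is a swap of components. *)
Definition perm_group (X : Type) : Group.
Proof.
  refine {| gcar := {f : (X -> X) * (X -> X) |
      (forall x, fst f (snd f x) = x) /\ (forall x, snd f (fst f x) = x)};
    gmul := fun f g => exist _ (fun x => fst (proj1_sig f) (fst (proj1_sig g) x),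
                                fun x => snd (proj1_sig g) (snd (proj1_sig f) x)) _;
    ginv := fun f => exist _ (snd (proj1_sig f), fst (proj1_sig f)) _;
    gone := exist _ (fun x => x, fun x => x) _ |}.
  - intros f g h; now apply subset_eq_compat.
  - intros [[f f'] Hf]; now apply subset_eq_compat.
  - intros [[f f'] [H1 H2]]; apply subset_eq_compat; simpl in *.
    f_equal; now apply functional_extensionality.
  Unshelve.
  + destruct f as [f [f1 f2]], g as [g [g1 g2]]; simpl; split; intros x.
    * now rewrite g1, f1.
    * now rewrite f2, g2.
  + destruct f as [f [f1 f2]]; now split.
  + now split.
Defined.

Inductive word (A : Group) :=
  | wnil (d : A)
  | wcons (e : bool) (r : A) (w : word A).
Arguments wnil {A}. Arguments wcons {A}.

(* [E true] and [E false] are the two associated subgroups and [psi e] maps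
   [E e] onto [E (negb e)]; [wcons e1 r1 (.. (wnil d))] stands for
   [r1 t^e1 r2 t^e2 .. d], where [true] and [false] are the exponents 1 and -1. *)
Section NormalForms.
Context {A : Group} (E : bool -> A -> Prop) (psi : bool -> A -> A).
Hypothesis HE : forall e, subgroup (E e).
Hypothesis psiE : forall e x, E e x -> E (negb e) (psi e x).
Hypothesis psiM : forall e, hom_on (E e) (psi e).
Hypothesis psiK : forall e x, E e x -> psi (negb e) (psi e x) = x.

(** A transversal of the left cosets of [E e] with 1 representing [E e] itself, so that a trivial
    representative detects a possible cancellation. *)
Definition rep (e : bool) (a : A) : A :=
  if excluded_middle_informative (E e a) then 1
  else epsilon (inhabits 1) (fun r => E e (r^-1 * a)).

Lemma rep_spec e a : E e ((rep e a)^-1 * a).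
Proof.
  unfold rep; destruct excluded_middle_informative as [H|H].
  - now autorewrite with grp.
  - apply (epsilon_spec (inhabits 1) (fun r => E e (r^-1 * a))).
    exists a; rewrite ginv_l; apply HE.
Qed.

Lemma rep_eq e x y : E e (x^-1 * y) -> rep e x = rep e y.
Proof.
  intros H; assert (Eq : (fun r => E e (r^-1 * x)) = (fun r => E e (r^-1 * y))).
  { apply functional_extensionality; intros r; apply propositional_extensionality; split.
    - intros Hx; replace (r^-1 * y) with ((r^-1 * x) * (x^-1 * y)) by grp; now apply HE.
    - intros Hy; replace (r^-1 * x) with ((r^-1 * y) * (x^-1 * y)^-1) by grp.
      apply HE; trivial; now apply HE. }
  unfold rep; rewrite Eq; apply (f_equal (fun P => P 1)) in Eq.
  autorewrite with grp in Eq.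
  destruct (excluded_middle_informative (E e x)) as [Hx|Hx],
    (excluded_middle_informative (E e y)) as [Hy|Hy]; trivial; exfalso; rewrite Eq in Hx; auto.
Qed.

Lemma rep_in e x : E e x -> rep e x = 1.
Proof. unfold rep; now destruct excluded_middle_informative. Qed.

Lemma rep_eq1 e x : rep e x = 1 -> E e x.
Proof. intros H; pose proof (rep_spec e x) as R; now rewrite H, ginv1, gone_l in R. Qed.

Lemma rep_rep e x : rep e (rep e x) = rep e x.
Proof. apply rep_eq, rep_spec. Qed.

(** Left multiplication by [a]: [a * r] is a representative times an element of [E e], and the
    latter moves past the stable letter through [psi e]. *)
Fixpoint act (a : A) (w : word A) : word A :=
  match w with
  | wnil d => wnil (a * d)
  | wcons e r w => wcons e (rep e (a * r)) (act (psi e ((rep e (a * r))^-1 * (a * r))) w)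
  end.

Definition cancels (e : bool) (w : word A) : Prop :=
  match w with wnil _ => False | wcons e' r _ => e' = negb e /\ r = 1 end.

Fixpoint reduced (w : word A) : Prop :=
  match w with
  | wnil _ => True
  | wcons e r w => rep e r = r /\ ~ cancels e w /\ reduced w
  end.

(** Left multiplication by [t^e]. The inner [wnil] branch is a filler, since [cancels] is false on
    such words. *)
Definition shift (e : bool) (w : word A) : word A :=
  if excluded_middle_informative (cancels e w)
  then match w with wnil d => wnil d | wcons _ _ w' => w' end
  else wcons e 1 w.

Fixpoint rmul (w : word A) (a : A) : word A :=
  match w with wnil d => wnil (d * a) | wcons e r w => wcons e r (rmul w a) end.

Lemma shift_cancels e w : shift e (wcons (negb e) 1 w) = w.
Proof.
  unfold shift; destruct excluded_middle_informative as [H|H]; trivial.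
  exfalso; apply H; now split.
Qed.

Lemma shift_not_cancels e w : ~ cancels e w -> shift e w = wcons e 1 w.
Proof. intros H; unfold shift; now destruct excluded_middle_informative. Qed.

Lemma cancelsP e w : cancels e w -> exists w', w = wcons (negb e) 1 w'.
Proof. destruct w as [d|e' r w]; [easy|]; intros [-> ->]; now exists w. Qed.

Lemma cancels_act e a w :
  reduced w -> E (negb e) a -> cancels e (act a w) -> cancels e w.
Proof.
  destruct w as [d|e' r w]; [easy|]; intros (Hr & _) Ha [-> H]; split; trivial.
  rewrite <- Hr; apply rep_in; apply rep_eq1 in H.
  replace r with (a^-1 * (a * r)) by grp; apply HE; trivial; now apply HE.
Qed.

Lemma act_reduced w : forall a, reduced w -> reduced (act a w).
Proof.
  induction w as [d|e r w IH]; intros a; simpl; trivial; intros (Hr & Hc & Hw).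
  split; [apply rep_rep|split; [|now apply IH]].
  intros H; apply Hc; apply (cancels_act e _ w Hw) in H; trivial.
  apply psiE, rep_spec.
Qed.

Lemma act_mul w : forall a b, act (a * b) w = act a (act b w).
Proof.
  induction w as [d|e r w IH]; intros a b; simpl; [now rewrite gmulA|].
  set (r1 := rep e (b * r)).
  assert (R : rep e (a * r1) = rep e (a * b * r)).
  { apply rep_eq; replace ((a * r1)^-1 * (a * b * r)) with (r1^-1 * (b * r)) by grp.
    apply rep_spec. }
  rewrite R, <- IH; f_equal; f_equal.
  rewrite <- (psiM e).
  - f_equal; grp.
  - rewrite <- R; apply rep_spec.
  - apply rep_spec.
Qed.

Lemma psi1 e : psi e 1 = 1.
Proof. now apply (hom_on1 (E e)). Qed.

Lemma act1 w : reduced w -> act 1 w = w.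
Proof.
  induction w as [d|e r w IH]; simpl; [now rewrite gone_l|].
  intros (Hr & _ & Hw); rewrite gone_l, Hr, ginv_l, psi1, IH; trivial.
Qed.

Lemma shift_reduced e w : reduced w -> reduced (shift e w).
Proof.
  intros Hw; destruct (classic (cancels e w)) as [H|H].
  - destruct (cancelsP _ _ H) as [w' ->]; rewrite shift_cancels; apply Hw.
  - rewrite shift_not_cancels by trivial; split; [apply rep_in, HE|now split].
Qed.

Lemma shiftK e w : reduced w -> shift (negb e) (shift e w) = w.
Proof.
  intros Hw; destruct (classic (cancels e w)) as [H|H].
  - destruct (cancelsP _ _ H) as [w' ->]; rewrite shift_cancels.
    apply shift_not_cancels, Hw.
  - rewrite (shift_not_cancels e) by trivial.
    rewrite <- (negb_involutive e) at 2; apply shift_cancels.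
Qed.

(** This is the HNN relation on normal forms, the hypothesis that the universal property asks of the
    action. *)
Lemma act_shift e c w :
  reduced w -> E e c -> act c (shift e w) = shift e (act (psi e c) w).
Proof.
  intros Hw Hc; pose proof (psiE e c Hc) as Hd; destruct (classic (cancels e w)) as [H|H].
  - destruct (cancelsP _ _ H) as [w' ->]; rewrite shift_cancels; simpl.
    now rewrite gmul1, (rep_in _ _ Hd), shift_cancels, ginv1, gone_l, psiK.
  - rewrite !shift_not_cancels; trivial.
    + simpl; now rewrite gmul1, (rep_in _ _ Hc), ginv1, gone_l.
    + intros H'; apply H; now apply (cancels_act e (psi e c)).
Qed.

Lemma rmul_reduced w a : reduced w -> reduced (rmul w a).
Proof.
  induction w as [d|e r w IH]; simpl; trivial; intros (Hr & Hc & Hw).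
  split; [trivial|split; [|auto]]; intros H; apply Hc; now destruct w.
Qed.

Definition nform := {w : word A | reduced w}.

Definition nform_act (a : A) (x : nform) : nform :=
  exist _ (act a (proj1_sig x)) (act_reduced _ a (proj2_sig x)).

Definition nform_shift (e : bool) (x : nform) : nform :=
  exist _ (shift e (proj1_sig x)) (shift_reduced e _ (proj2_sig x)).

Lemma nform_eq (x y : nform) : proj1_sig x = proj1_sig y -> x = y.
Proof. destruct x, y; apply subset_eq_compat. Qed.

Definition perm_act (a : A) : perm_group nform.
Proof.
  refine (exist _ (nform_act a, nform_act a^-1) _); simpl.
  split; intros x; apply nform_eq; simpl; rewrite <- act_mul; grp;
    apply act1, proj2_sig.
Defined.

Definition perm_shift : perm_group nform.
Proof.
  refine (exist _ (nform_shift true, nform_shift false) _); simpl.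
  split; intros x; apply nform_eq; simpl.
  - apply (shiftK false), proj2_sig.
  - apply (shiftK true), proj2_sig.
Defined.

Context {G : Group} (i : A -> G) (t : G).
Hypothesis HNN : is_HNN (E true) (psi true) i t.

Lemma perm_ext (X : Type) (f g : perm_group X) :
  (forall x, fst (proj1_sig f) x = fst (proj1_sig g) x) -> f = g.
Proof.
  destruct f as [[f f'] [f1 f2]], g as [[g g'] [g1 g2]]; simpl in *; intros H.
  apply subset_eq_compat; f_equal; apply functional_extensionality; trivial.
  intros x; now rewrite <- (g1 x) at 1; rewrite <- H.
Qed.

(** Van der Waerden's method: [G] acts by permutations on the set of normal forms. *)
Lemma HNN_normal_form_action : exists rho : G -> nform -> nform,
  (forall g h x, rho (g * h) x = rho g (rho h x)) /\ (forall x, rho 1 x = x) /\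
  (forall a x, rho (i a) x = nform_act a x) /\ (forall x, rho t x = nform_shift true x) /\
  (forall x, rho t^-1 x = nform_shift false x).
Proof.
  destruct HNN as (_ & _ & U).
  destruct (U (perm_group nform) perm_act perm_shift) as (f & hf & fi & ft & _).
  - intros a b; apply perm_ext; intros x; apply nform_eq; simpl; apply act_mul.
  - intros c Hc; apply perm_ext; intros x; apply nform_eq; simpl.
    rewrite (act_shift true) by (trivial; apply proj2_sig).
    apply (shiftK true), act_reduced, proj2_sig.
  - exists (fun g => fst (proj1_sig (f g))).
    split; [|split; [|split; [|split]]].
    + intros g h x; now rewrite hf.
    + intros x; now rewrite hom1.
    + intros a x; now rewrite fi.
    + intros x; now rewrite ft.
    + intros x; now rewrite homV, ft.
Qed.

Definition stable (e : bool) : G := if e then t else t^-1.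

Fixpoint eval (w : word A) : G :=
  match w with wnil d => i d | wcons e r w => i r * (stable e * eval w) end.

Lemma stable_rel e c : E e c -> i c * stable e = stable e * i (psi e c).
Proof.
  intros Hc; destruct e; simpl.
  - now apply (HNN_rel _ _ _ _ HNN).
  - pose proof (HNN_rel _ _ _ _ HNN _ (psiE _ _ Hc)) as H.
    simpl in H; rewrite (psiK false) in H by trivial.
    apply (gmul_cancel_l t), (gmul_cancel_r t); autorewrite with grp; now rewrite H.
Qed.

Lemma eval_act w : forall a, eval (act a w) = i a * eval w.
Proof.
  pose proof (HNN_hom _ _ _ _ HNN) as hi.
  induction w as [d|e r w IH]; intros a; simpl; [apply hi|].
  rewrite IH, (gassoc _ (stable e)), <- stable_rel by apply rep_spec.
  rewrite !hi, homV by trivial; grp.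
Qed.

Lemma eval_shift e w : eval (shift e w) = stable e * eval w.
Proof.
  pose proof (hom1 _ (HNN_hom _ _ _ _ HNN)) as i1.
  destruct (classic (cancels e w)) as [H|H].
  - destruct (cancelsP _ _ H) as [w' ->]; rewrite shift_cancels; simpl; rewrite i1.
    destruct e; simpl; grp.
  - rewrite shift_not_cancels by trivial; simpl; rewrite i1; grp.
Qed.

Lemma eval_rmul w a : eval (rmul w a) = eval w * i a.
Proof.
  pose proof (HNN_hom _ _ _ _ HNN) as hi.
  induction w as [d|e r w IH]; simpl; [apply hi|]; rewrite IH; grp.
Qed.

Lemma eval_reduced_surj g : exists w, reduced w /\ eval w = g.
Proof.
  destruct HNN_normal_form_action as (rho & rM & r1 & ri & rt & _).
  assert (ev : forall g x, eval (proj1_sig (rho g x)) = g * eval (proj1_sig x)).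
  { apply (HNN_generated _ _ _ _ HNN
      (fun g => forall x, eval (proj1_sig (rho g x)) = g * eval (proj1_sig x))).
    - split; [|split].
      + intros x; rewrite r1; grp.
      + intros x y Hx Hy z; rewrite rM, Hx, Hy; grp.
      + intros x Hx y; apply (gmul_cancel_l x); rewrite <- Hx, <- rM, gmulV, r1; grp.
    - intros a x; rewrite ri; apply eval_act.
    - intros x; rewrite rt; apply (eval_shift true). }
  set (x0 := exist _ (wnil 1) I : nform).
  exists (proj1_sig (rho g x0)); split; [apply proj2_sig|].
  rewrite ev; simpl; rewrite hom1 by apply (HNN_hom _ _ _ _ HNN); grp.
Qed.

(** Applying [eval w] to the trivial normal form gives back [w]. *)
Lemma eval_reduced_inj w w' : reduced w -> reduced w' -> eval w = eval w' -> w = w'.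
Proof.
  destruct HNN_normal_form_action as (rho & rM & r1 & ri & rt & rt').
  set (x0 := exist _ (wnil 1) I : nform).
  assert (nf : forall w, reduced w -> proj1_sig (rho (eval w) x0) = w).
  { clear w w'; induction w as [d|e r w IH]; simpl.
    - intros _; rewrite ri; simpl; now rewrite gmul1.
    - intros (Hr & Hc & Hw); rewrite !rM, ri; simpl.
      assert (Rs : forall x, rho (stable e) x = nform_shift e x) by (destruct e; trivial).
      rewrite Rs; simpl; rewrite IH, shift_not_cancels by trivial; simpl.
      now rewrite gmul1, Hr, ginv_l, psi1, act1. }
  intros Hw Hw' H; now rewrite <- (nf w), H, nf.
Qed.

Lemma HNN_base_inj a b : i a = i b -> a = b.
Proof.
  intros H; assert (Eq : wnil a = wnil b) by now apply eval_reduced_inj.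
  now injection Eq.
Qed.

(** The normal form of [i a * t] starts with the representative of [a], that of [t * i b] with 1. *)
Lemma HNN_conj_base a b : i a * t = t * i b -> E true a.
Proof.
  intros H; pose proof (hom1 _ (HNN_hom _ _ _ _ HNN)) as i1.
  assert (R : forall b, reduced (wcons true 1 (wnil b)))
    by (intros c; split; [apply rep_in, HE|split; simpl; tauto]).
  assert (Eq : act a (wcons true 1 (wnil 1)) = wcons true 1 (wnil b)).
  { apply eval_reduced_inj; [now apply act_reduced|trivial|].
    rewrite eval_act; simpl; rewrite i1, !gone_l, gmul1; exact H. }
  simpl in Eq; injection Eq as Eq _; rewrite gmul1 in Eq; now apply rep_eq1.
Qed.

(** Suppose the normal form of [g] starts with [r t^e]. Multiplying by [r a r^-1] on the right keeps
    [r], on the left it replaces [r] by the representative of [r a]; equality puts [a] in [E e]. *)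
Lemma HNN_centralizer_base g :
  (forall a, commute g (i a)) -> (exists a, g = i a) \/ exists e, forall a, E e a.
Proof.
  intros Hg; destruct (eval_reduced_surj g) as [w [Hw <-]].
  destruct w as [d|e r w]; [left; now exists d|right; exists e; intros a].
  assert (Eq : act (r * a * r^-1) (wcons e r w) = rmul (wcons e r w) (r * a * r^-1)).
  { apply eval_reduced_inj; [now apply act_reduced|now apply rmul_reduced|].
    rewrite eval_act, eval_rmul; symmetry; apply Hg. }
  simpl in Eq; injection Eq as Eq _.
  pose proof (rep_spec e (r * a * r^-1 * r)) as R; rewrite Eq in R.
  autorewrite with grp in R; exact R.
Qed.

End NormalForms.

(** * The twist does not extend *)

Lemma zpow_conjV {G : Group} (g x : G) n : (g^-1 * x * g) ^ n = g^-1 * x ^ n * g.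
Proof. rewrite <- (ginvK g) at 2 4; apply zpow_conj. Qed.

Lemma conj_zpow_scale {G : Group} (t c : G) (x y : Z) (m : nat) :
  c ^ x * t = t * c ^ y ->
  (t ^ Z.of_nat m)^-1 * c ^ (x ^ Z.of_nat m)%Z * t ^ Z.of_nat m = c ^ (y ^ Z.of_nat m)%Z.
Proof.
  intros H; induction m as [|m IH]; [simpl; grp|].
  rewrite !Zpow_S, Nat2Z.inj_succ, <- Z.add_1_r, zpow_add, zpow1.
  rewrite (Z.mul_comm x), zpow_mul.
  replace ((t ^ _ * t)^-1 * _ * _) with
    (t^-1 * ((t ^ Z.of_nat m)^-1 * (c ^ (x ^ Z.of_nat m)) ^ x * t ^ Z.of_nat m) * t) by grp.
  rewrite <- zpow_conjV, IH, <- zpow_mul, Z.mul_comm, zpow_mul, <- zpow_conjV.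
  replace (t^-1 * c ^ x * t) with (c ^ y); [now rewrite <- zpow_mul|].
  rewrite gmulA, H; grp.
Qed.

(* With t^-1 c^x t = c^y, the elements t^-k w t^k behave like the rational powers
   c^((a/b) (y/x)^k), so (t w)^p = t^(p-1) c t says that the geometric sum divides
   a power of x y. *)
Lemma no_twisted_root {G : Group} (t c w : G) (x y a b : Z) (M k : nat) :
  unique_root G -> (forall n, c ^ n = 1 -> n = 0%Z) ->
  rel_prime x y -> x <> 0%Z -> y <> 0%Z -> c ^ x * t = t * c ^ y ->
  w ^ b = c ^ a -> b <> 0%Z -> (b | (x * y) ^ Z.of_nat M)%Z ->
  (t * w) ^ Z.of_nat (2 * k + 3) <> t ^ (Z.of_nat (2 * k + 3) - 1) * c * t.
Proof.
  intros UR Hc Hp Hx Hy Ht Hw Hb HbM Hz.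
  assert (inj : forall m n, c ^ m = c ^ n -> m = n).
  { intros m n E; enough (m - n = 0)%Z by lia; apply Hc.
    rewrite zpow_sub, E; grp. }
  assert (Hxy : (x + y <> 0)%Z).
  { intros Hxy; replace y with (- x)%Z in Ht by lia; rewrite zpow_opp in Ht.
    apply Hx, Hc, (gmul_cancel_l t); rewrite gmul1.
    apply (unique_zroot UR _ _ 2); [easy|]; change 2%Z with (1 + 1)%Z.
    rewrite !zpow_succ, !zpow1, !gmulA, (gassoc _ (c ^ x)), Ht; grp. }
  assert (conj : forall m, ((t ^ Z.of_nat m)^-1 * w * t ^ Z.of_nat m) ^ (b * x ^ Z.of_nat m)
                 = c ^ (a * y ^ Z.of_nat m)).
  { intros m; rewrite zpow_conjV, zpow_mul, Hw, <- zpow_mul, Z.mul_comm, zpow_mul.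
    rewrite <- zpow_conjV, conj_zpow_scale with (1 := Ht).
    now rewrite <- zpow_mul, Z.mul_comm. }
  assert (nz : forall m, (b * x ^ Z.of_nat m <> 0)%Z).
  { intros m; pose proof (Z.pow_nonzero x (Z.of_nat m) Hx ltac:(lia)); nia. }
  (* The element [t^-m (t w)^m] is the product of the conjugates [t^-k w t^k] for [k < m]. They have
     nonzero powers in the cyclic group of [c], hence commute, and their exponents add up to the
     geometric sum. *)
  assert (Q : forall m, ((t ^ Z.of_nat m)^-1 * (t * w) ^ Z.of_nat m) ^ (b * x ^ Z.of_nat m)
              = c ^ (a * x * geom x y m)).
  { induction m as [|m IH].
    - simpl geom; rewrite Z.mul_0_r; simpl Z.of_nat; cbn [zpow]; rewrite ginv_l; apply zpow_one.
    - rewrite Nat2Z.inj_succ, <- Z.add_1_r at 1 2.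
      rewrite !zpow_succ.
      replace ((t * t ^ Z.of_nat m)^-1 * _) with (((t ^ Z.of_nat m)^-1 * w * t ^ Z.of_nat m) *
        ((t ^ Z.of_nat m)^-1 * (t * w) ^ Z.of_nat m)) by grp.
      rewrite zpow_mul_commute.
      + rewrite Zpow_S; replace (b * (x * x ^ Z.of_nat m))%Z with (b * x ^ Z.of_nat m * x)%Z by ring.
        rewrite (zpow_mul (_ * w * _)), (zpow_mul (_^-1 * (t * w) ^ _)), conj, IH.
        rewrite <- !zpow_mul, <- zpow_add; f_equal; simpl geom; ring.
      + apply (commute_of_common_power UR _ _ c _ _ _ _ (nz m) (nz m) (conj m) IH). }
  set (p := (2 * k + 3)%nat) in *; specialize (Q p); rewrite Hz in Q.
  replace ((t ^ Z.of_nat p)^-1 * (t ^ (Z.of_nat p - 1) * c * t)) with (t^-1 * c * t) in Q.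
  2:{ replace (t ^ Z.of_nat p) with (t ^ (Z.of_nat p - 1) * t); [grp|].
      rewrite <- (zpow1 t) at 2; rewrite <- zpow_add; f_equal; lia. }
  assert (Ex : (t^-1 * c * t) ^ x = c ^ y) by (rewrite zpow_conjV, gmulA, Ht; grp).
  replace (b * x ^ Z.of_nat p)%Z with (x * (b * x ^ Z.of_nat (2 * k + 2)))%Z in Q.
  2:{ unfold p; replace (2 * k + 3)%nat with (S (2 * k + 2)) by lia; rewrite Zpow_S; ring. }
  rewrite zpow_mul, Ex, <- zpow_mul in Q; apply inj in Q.
  (* Comparing exponents of [c] gave [y b x^(p-1) = a x geom x y p]. As [b] divides [(x y)^M], the
     left side divides [(x y)^(M+p)]. *)
  apply (geom_not_dvd_pow x y k (M + (2 * k + 3)) Hp Hx Hy Hxy); fold p.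
  apply Z.divide_trans with (y * (b * x ^ Z.of_nat (2 * k + 2)))%Z.
  - rewrite Q; exists (a * x)%Z; ring.
  - destruct HbM as [q Hq].
    rewrite (Nat2Z.inj_add M), Z.pow_add_r, Hq by lia.
    unfold p; replace (2 * k + 3)%nat with (S (2 * k + 2)) by lia.
    rewrite Z.pow_mul_l, !Zpow_S; exists (q * x * y ^ Z.of_nat (2 * k + 2))%Z; ring.
Qed.

Section NoRoot.
Context {A G : Group} (C D : A -> Prop) (phi : A -> A) (i : A -> G) (t : G).
Hypothesis HNN : is_HNN C phi i t.

(** When [s] conjugates the base into itself, positive powers of [s] can be gathered on the left and
    negative ones on the right. The letter is kept abstract to serve for both [t] and [t^-1]. *)
Lemma ascending_form (s : G) :
  (forall P, subgroup P -> (forall a, P (i a)) -> P s -> forall g : G, P g) ->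
  (forall a, exists b, i a * s = s * i b) ->
  forall g, exists (j k : nat) a, g = s ^ Z.of_nat j * i a * (s ^ Z.of_nat k)^-1.
Proof.
  intros gen asc; pose proof (HNN_hom _ _ _ _ HNN) as hi.
  assert (asc' : forall (m : nat) a, exists b, i a * s ^ Z.of_nat m = s ^ Z.of_nat m * i b).
  { induction m as [|m IH]; intros a; [exists a; simpl; grp|].
    destruct (asc a) as [b Hb], (IH b) as [b' Hb']; exists b'.
    rewrite Nat2Z.inj_succ, <- Z.add_1_r, zpow_succ, gassoc, Hb, !gmulA, Hb'; grp. }
  assert (mul : forall (j k j' k' : nat) a a', (k <= j')%nat -> exists (j0 k0 : nat) a0,
    (s ^ Z.of_nat j * i a * (s ^ Z.of_nat k)^-1) *
    (s ^ Z.of_nat j' * i a' * (s ^ Z.of_nat k')^-1)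
    = s ^ Z.of_nat j0 * i a0 * (s ^ Z.of_nat k0)^-1).
  { intros j k j' k' a a' Hk; destruct (asc' (j' - k)%nat a) as [b Hb].
    exists (j + (j' - k))%nat, k', (b * a').
    rewrite hi, (Nat2Z.inj_add j), zpow_add.
    replace (Z.of_nat j') with (Z.of_nat k + Z.of_nat (j' - k))%Z by lia.
    rewrite zpow_add; autorewrite with grp; rewrite (gassoc _ (i a)), Hb; grp. }
  apply gen.
  - split; [|split].
    + exists 0%nat, 0%nat, 1; rewrite hom1 by trivial; simpl; grp.
    + intros _ _ (j & k & a & ->) (j' & k' & a' & ->).
      destruct (Nat.le_gt_cases k j') as [H|H]; [now apply mul|].
      (* The case [j' < k] is the inverse of a product already treated. *)
      destruct (mul k' j' k j (a'^-1) (a^-1)) as (j0 & k0 & a0 & E); [lia|].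
      exists k0, j0, (a0^-1).
      apply (f_equal ginv) in E; rewrite !(homV i) in E by trivial; rewrite (homV i) by trivial.
      autorewrite with grp in *; exact E.
    + intros _ (j & k & a & ->); exists k, j, (a^-1); rewrite (homV i) by trivial; grp.
  - intros a; exists 0%nat, 0%nat, a; simpl; grp.
  - exists 1%nat, 0%nat, 1; rewrite hom1 by trivial; simpl; grp.
Qed.

Hypothesis HCC : infinite_cyclic C.
Hypothesis HDD : infinite_cyclic D.
Hypothesis Hphi : iso_on C D phi.
Hypothesis UR : unique_root G.

Lemma cyclic_subgroup {H : Group} (K : H -> Prop) : infinite_cyclic K -> subgroup K.
Proof.
  intros [c [Hc _]]; split; [|split].
  - apply Hc; now exists 0%Z.
  - intros x y Hx Hy; apply Hc in Hx as [m ->], Hy as [n ->]; apply Hc.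
    exists (m + n)%Z; symmetry; apply zpow_add.
  - intros x Hx; apply Hc in Hx as [m ->]; apply Hc.
    exists (- m)%Z; symmetry; apply zpow_opp.
Qed.

Definition edge (e : bool) : A -> Prop := if e then C else D.

Definition edge_map (e : bool) : A -> A :=
  if e then phi else fun y => epsilon (inhabits 1) (fun x => C x /\ phi x = y).

Lemma edge_subgroup e : subgroup (edge e).
Proof. destruct e; now apply cyclic_subgroup. Qed.

Lemma edge_map_inv y : D y -> C (edge_map false y) /\ phi (edge_map false y) = y.
Proof.
  intros Hy; apply (epsilon_spec (inhabits 1) (fun x => C x /\ phi x = y)); now apply Hphi.
Qed.

Lemma edge_mapE e x : edge e x -> edge (negb e) (edge_map e x).
Proof.
  destruct e; simpl; intros Hx; [now apply Hphi|now apply edge_map_inv].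
Qed.

Lemma edge_mapK e x : edge e x -> edge_map (negb e) (edge_map e x) = x.
Proof.
  destruct Hphi as (_ & h & inj & _).
  destruct e; intros Hx; [|now apply edge_map_inv].
  destruct (edge_map_inv (phi x)) as [H1 H2]; auto.
Qed.

Lemma edge_mapM e : hom_on (edge e) (edge_map e).
Proof.
  destruct Hphi as (h & _ & inj & _); destruct e; [exact h|].
  intros x y Hx Hy; pose proof (edge_subgroup true) as SC; pose proof (edge_subgroup false) as SD.
  destruct (edge_map_inv x Hx) as [Cx Ex], (edge_map_inv y Hy) as [Cy Ey].
  destruct (edge_map_inv (x * y)) as [Cxy Exy]; [now apply SD|].
  apply inj; trivial; [now apply SC|].
  rewrite h by trivial; now rewrite Exy, Ex, Ey.
Qed.

Lemma base_inj a b : i a = i b -> a = b.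
Proof.
  apply (HNN_base_inj edge edge_map edge_subgroup edge_mapE edge_mapM edge_mapK i t HNN).
Qed.

Lemma conj_base a b : i a * t = t * i b -> C a.
Proof.
  apply (HNN_conj_base edge edge_map edge_subgroup edge_mapE edge_mapM edge_mapK i t HNN).
Qed.

Lemma centralizer_base g :
  centralizes i g -> (exists a, g = i a) \/ (forall a, C a) \/ (forall a, D a).
Proof.
  intros Hg.
  destruct (HNN_centralizer_base edge edge_map edge_subgroup edge_mapE edge_mapM edge_mapK
    i t HNN g Hg) as [H|[[|] H]]; auto.
Qed.

Lemma HNN_no_root (eps : G -> Z) (c : A) (w : G) (k : nat) :
  is_exponent i t eps ->
  (forall h, C h <-> exists n, h = c ^ n) -> (forall n, c ^ n = 1 -> n = 0%Z) ->
  centralizes i w -> centralizes i (t^-1 * w * t) -> centralizes i (t ^ (-2) * w * t ^ 2) ->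
  (t * w) ^ Z.of_nat (2 * k + 3) <> t ^ (Z.of_nat (2 * k + 3) - 1) * i c * t.
Proof.
  intros Heps HC Hc W0 W1 W2 Hz.
  pose proof (HNN_hom _ _ _ _ HNN) as hi; pose proof (edge_subgroup true) as SC.
  assert (Cc : C c) by (apply HC; exists 1%Z; now rewrite zpow1).
  pose proof (iso_on_hom_on _ _ _ Hphi) as hphi.
  assert (iX : forall a n, i (a ^ n) = i a ^ n) by (intros; now apply hom_zpow).
  assert (Hic : forall n, i c ^ n = 1 -> n = 0%Z).
  { intros n E; apply Hc, base_inj; now rewrite iX, hom1. }
  set (d := phi c).
  assert (phiX : forall n, phi (c ^ n) = d ^ n) by (intros n; now apply (hom_on_zpow C)).
  assert (rel : forall n, i c ^ n * t = t * i d ^ n).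
  { intros n; rewrite <- !iX, <- phiX; apply (HNN_rel _ _ _ _ HNN).
    now apply (subgroup_zpow C). }
  assert (Hd : forall n, d ^ n = 1 -> n = 0%Z).
  { intros n E; apply Hc; destruct Hphi as (_ & _ & inj & _); apply inj.
    - now apply (subgroup_zpow C).
    - apply SC.
    - rewrite phiX, E; symmetry; now apply (hom_on1 C). }
  assert (HD : forall h, D h -> exists n, h = d ^ n).
  { intros h Dh; destruct Hphi as (_ & _ & _ & surj); destruct (surj h Dh) as [x [Cx <-]].
    apply HC in Cx as [n ->]; exists n; apply phiX. }
  (* Exponent sums of the two sides of [Hz] give [p (1 + eps w) = p]. *)
  assert (Hw0 : eps w = 0%Z).
  { apply (f_equal eps) in Hz; rewrite !(eps_mul _ _ _ Heps), !(eps_zpow _ _ _ Heps) in Hz.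
    rewrite (eps_mul _ _ _ Heps), (eps_base _ _ _ Heps), (eps_t _ _ _ Heps) in Hz; nia. }
  assert (caseC : ~ forall a, C a).
  { intros AC; destruct (proj1 (HC d) (AC d)) as [n Hn].
    assert (Hn0 : n <> 0%Z).
    { intros ->; enough (1 = 0)%Z by lia; apply Hd; now rewrite zpow1, Hn. }
    assert (Ht : i c ^ 1 * t = t * i c ^ n) by (now rewrite rel, zpow1, Hn, iX).
    destruct (ascending_form t (HNN_generated _ _ _ _ HNN)) with (g := w)
      as (j & k' & a & Ew).
    { intros a; exists (phi a); now apply (HNN_rel _ _ _ _ HNN). }
    assert (k' = j) as ->.
    { rewrite Ew, !(eps_mul _ _ _ Heps), (epsV _ _ _ Heps), !(eps_zpow _ _ _ Heps),
        (eps_t _ _ _ Heps), (eps_base _ _ _ Heps) in Hw0; lia. }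
    destruct (proj1 (HC a) (AC a)) as [m ->].
    (* Here [w = t^j c^m t^-j] and [t^-j c t^j = c^(n^j)], so [w^(n^j) = c^m]. *)
    apply (no_twisted_root t (i c) w 1 n m (n ^ Z.of_nat j) j k UR Hic); trivial; try lia.
    - apply rel_prime_1.
    - rewrite Ew, iX, zpow_conj, <- zpow_mul, Z.mul_comm, zpow_mul.
      rewrite <- (conj_zpow_scale t (i c) 1 n j Ht), Z.pow_1_l, zpow1 by lia.
      rewrite zpow_conjV; grp.
    - apply Z.pow_nonzero; lia.
    - rewrite Z.mul_1_l; apply Z.divide_refl. }
  assert (caseD : ~ forall a, D a).
  { intros AD; destruct (HD c (AD c)) as [n Hn].
    assert (Hn0 : n <> 0%Z).
    { intros ->; enough (1 = 0)%Z by lia; apply Hc; now rewrite zpow1, Hn. }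
    assert (Ht : i c ^ n * t = t * i c ^ 1) by (now rewrite rel, zpow1, <- iX, <- Hn).
    destruct (ascending_form t^-1) with (g := w) as (j & k' & a & Ew).
    { intros P HP Pi Pt; apply (HNN_generated _ _ _ _ HNN); trivial.
      rewrite <- (ginvK t); now apply HP. }
    { intros a; destruct (HD a (AD a)) as [m ->]; exists (c ^ m).
      apply (gmul_cancel_l t), (gmul_cancel_r t); autorewrite with grp.
      now rewrite !iX, rel. }
    assert (k' = j) as ->.
    { rewrite Ew, !(eps_mul _ _ _ Heps), (epsV _ _ _ Heps), !(eps_zpow _ _ _ Heps),
        (epsV _ _ _ Heps), (eps_t _ _ _ Heps), (eps_base _ _ _ Heps) in Hw0; lia. }
    assert (tV : (t^-1) ^ Z.of_nat j = (t ^ Z.of_nat j)^-1).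
    { now rewrite <- zpow_opp, <- (zpow1 t), <- zpow_opp, <- !zpow_mul, Z.mul_1_l,
        Z.mul_opp_l, Z.mul_1_l. }
    destruct (HD a (AD a)) as [m ->].
    (* Now [w = t^-j d^m t^j] with [d^n = c]; the extra factor [n] in the exponent [n^(j+1)]
       converts [d] into [c]. *)
    apply (no_twisted_root t (i c) w n 1 m (n ^ Z.of_nat (S j)) (S j) k UR Hic); trivial; try lia.
    - apply rel_prime_sym, rel_prime_1.
    - rewrite Ew, tV, ginvK, iX, zpow_conjV, Zpow_S, <- !zpow_mul.
      replace (m * (n * n ^ Z.of_nat j))%Z with (n * (n ^ Z.of_nat j * m))%Z by ring.
      rewrite zpow_mul, <- (iX d n), <- Hn, zpow_mul, <- zpow_conjV.
      now rewrite (conj_zpow_scale t (i c) n 1 j Ht), Z.pow_1_l, zpow1 by lia.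
    - apply Z.pow_nonzero; lia.
    - rewrite Z.mul_1_r; apply Z.divide_refl. }
  assert (central : forall g, centralizes i g -> exists a, g = i a).
  { intros g Hg; destruct (centralizer_base g Hg) as [H|[H|H]]; tauto. }
  (* Neither [C] nor [D] is all of [A], so [w] and its two conjugates lie in [A]. As conjugation by
     [t] keeps the first two in [A], these lie in [C]: [w = c^m] and [t^-1 w t = c^l]. *)
  destruct (central _ W0) as [a0 E0], (central _ W1) as [a1 E1], (central _ W2) as [a2 E2].
  assert (R1 : i a0 * t = t * i a1) by (rewrite <- E0, <- E1; grp).
  assert (R2 : i a1 * t = t * i a2).
  { rewrite <- E1, <- E2; change (-2)%Z with (- (1 + 1))%Z; change 2%Z with (1 + 1)%Z.
    rewrite zpow_opp, !zpow_succ, !zpow1; grp. }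
  pose proof (conj_base _ _ R1) as C0; pose proof (conj_base _ _ R2) as C1.
  apply HC in C0 as [m ->]; apply HC in C1 as [l ->].
  rewrite !iX, rel in R1; apply gmul_cancel_l in R1.
  destruct (Z.eq_dec m 0) as [->|Hm].
  { enough (1 = 0)%Z by lia; apply Hic; rewrite zpow1.
    rewrite iX, zpow0 in E0; rewrite E0, gmul1 in Hz.
    set (q := Z.of_nat (2 * k + 3)) in *.
    replace q with (q - 1 + 1)%Z in Hz at 1 by lia.
    rewrite zpow_add, zpow1, gmulA in Hz; apply gmul_cancel_l in Hz.
    apply (gmul_cancel_r t); now rewrite gone_l. }
  assert (Hl : l <> 0%Z).
  { intros ->; apply Hm, Hd, base_inj; now rewrite iX, R1, hom1. }
  assert (Hg : Z.gcd m l <> 0%Z) by (intros H; apply Z.gcd_eq_0_l in H; tauto).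
  (* From [d^m = c^l], unique roots allow division by the gcd, giving coprime exponents with
     [d^x = c^y]. *)
  destruct (Z.gcd_divide_l m l) as [x Hx], (Z.gcd_divide_r m l) as [y Hy].
  apply (no_twisted_root t (i c) w x y m 1 0 k UR Hic); trivial; try nia.
  - apply Zgcd_1_rel_prime.
    pose proof (Z.gcd_mul_mono_r_nonneg x y (Z.gcd m l) (Z.gcd_nonneg m l)) as H.
    rewrite <- Hx, <- Hy in H; nia.
  - rewrite rel; f_equal; apply (unique_zroot UR _ _ _ Hg).
    now rewrite <- !zpow_mul, <- Hx, <- Hy.
  - now rewrite zpow1, E0, iX.
  - apply Z.divide_1_l.
Qed.

End NoRoot.

(** * Choice of [p] and conclusion *)

Lemma fact_divide (N : nat) (m : Z) :
  (1 <= m <= Z.of_nat N)%Z -> (m | Z.of_nat (fact N))%Z.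
Proof.
  induction N as [|N IH]; intros Hm; [lia|].
  change (fact (S N)) with (S N * fact N)%nat; rewrite Nat2Z.inj_mul.
  destruct (Z.eq_dec m (Z.of_nat (S N))) as [->|Hne].
  - apply Z.divide_factor_l.
  - apply Z.divide_mul_r, IH; lia.
Qed.

(** Exponents at most [N] divide [N!], hence are prime to [2 N! + 1]; the factor 2 makes this
    modulus odd. *)
Lemma finite_index_coprime_dense {G : Group} (K : G -> Prop) (reps : list G) (N : nat) :
  subgroup K -> (forall g, exists r, In r reps /\ K (r^-1 * g)) -> (length reps <= N)%nat ->
  coprime_dense (2 * Z.of_nat (fact N) + 1) K.
Proof.
  intros HK Hr HN; split; trivial; intros x.
  destruct (finite_index_zpow K reps HK Hr x) as [m [Hm Km]]; exists m; split; trivial.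
  destruct (fact_divide N m) as [q Hq]; [lia|]; rewrite Hq.
  apply bezout_rel_prime, (Bezout_intro _ _ _ (- 2 * q) 1); ring.
Qed.

Lemma comm_list_coprime_dense {G : Group} (S : list (PIso G)) :
  (forall a, In a S -> is_comm a) ->
  exists N0, forall N, (N0 <= N)%nat -> forall a, In a S ->
    coprime_dense (2 * Z.of_nat (fact N) + 1) (pdom a) /\
    coprime_dense (2 * Z.of_nat (fact N) + 1) (pcod a).
Proof.
  induction S as [|a S IH]; intros HS; [now exists 0%nat|].
  destruct IH as [N1 H1]; [intros b Hb; apply HS; now right|].
  destruct (HS a) as ((Kd & rd & Hd) & (Kc & rc & Hc) & _); [now left|].
  exists (N1 + length rd + length rc)%nat; intros N HN b [<-|Hb].
  - split; [apply (finite_index_coprime_dense _ rd)|apply (finite_index_coprime_dense _ rc)];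
      trivial; lia.
  - apply H1; trivial; lia.
Qed.

Theorem theorem4p2 (A G : Group) (C D : A -> Prop) (phi : A -> A)
    (i : A -> G) (t : G) :
  infinite_cyclic C -> infinite_cyclic D -> iso_on C D phi ->
  is_HNN C phi i t ->
  unique_root G ->
  ~ comm_fin_gen G.
Proof.
  intros HCC HDD Hphi HNN UR (S & HS & Hgen).
  destruct (comm_list_coprime_dense S HS) as [N0 HN0].
  (* Adding 2 makes [F >= 2], so [p] is odd and at least 5. *)
  set (F := fact (N0 + 2)); set (p := (2 * Z.of_nat F + 1)%Z).
  assert (HF : (2 <= F)%nat).
  { unfold F; rewrite Nat.add_comm; simpl; pose proof (lt_O_fact N0); nia. }
  destruct (HCC) as [c [HC Hc]].
  assert (Cc : C c) by (apply HC; exists 1%Z; now rewrite zpow1).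
  pose proof (HNN_hom _ _ _ _ HNN) as hi.
  (* The trivial twist is used only to obtain the exponent sum. *)
  destruct (shift_hom_exists C phi i t HNN (fun _ => 1)) as (eps & _ & Heps & _).
  { intros n x _; unfold commute; grp. }
  assert (comm : forall n x, C x -> commute (i (edge_twist p c n)) (i x)).
  { intros n x Hx; unfold commute; rewrite <- !hi; f_equal; unfold edge_twist.
    destruct (_ =? _)%Z; [|grp]; apply HC in Hx as [m ->].
    rewrite <- (zpow1 c) at 1 4; apply zpow_commute. }
  destruct (twist_exists C phi i t HNN eps Heps _ comm) as [theta Ht].
  destruct (twist_exists C phi i t HNN eps Heps (fun n => (i (edge_twist p c n))^-1))
    as [theta' Ht'].
  { intros n x Hx; apply commute_sym, commute_inv, commute_sym; auto. }
  pose proof (edge_twist_is_comm C phi i t HNN eps Heps p c theta theta' ltac:(lia) Ht Ht') as HT.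
  apply Hgen, (comm_gen_model p) in HT; [|lia|].
  - destruct (edge_twist_root C phi i t HNN UR eps Heps p c theta ltac:(lia) Ht HT)
      as (w & Hz & W0 & W1 & W2).
    replace p with (Z.of_nat (2 * (F - 1) + 3)) in Hz by lia.
    revert Hz; now apply (HNN_no_root C D phi i t HNN HCC HDD Hphi UR eps c w).
  - intros a Ha; destruct (HN0 (N0 + 2)%nat ltac:(lia) a Ha) as [Da Dc].
    apply model_base; auto.
Qed.
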